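(* Let $\chi$ be a smooth non-negative concave function on $(0,\infty)$. The distance on $(\mathcal M_1,\mathcal G)$ is non-increasing along the $\chi$ flow, in the following sense: if $u(t,s)$, $s\in[0,1]$, is a smooth family of positive functions on $S^1$ with $\int_{S^1}u=1$ such that for each $s$, $t\mapsto u(t,s)$ solves the $\chi$ flow $u_t=-(\chi_{uu}u_xu)_x$, then $$\partial_t\|u_s\|_{\mathcal G}^2=2\int_{S^1}\chi_{uu}\,K(u_s)^2\le0,\qquad K(u_s)=u_s-\frac{Q(u_s)u_x}{u}.$$ Furthermore, along the $\chi$ flow, $\partial_t^2\mathrm{Vol}_\chi=\partial_t\mathcal E[u(t)]=2\int_{S^1}\chi_{uu}K(u_t)^2\le0$.
   Context: $S^1=\mathbb R/\mathbb Z$ (unit length) with coordinate $x$. $\mathcal M_1$ is identified with the space of smooth $u:S^1\to(0,\infty)$ with $\int_{S^1}u=1$ (parametrising closed $G_2$-structures $d\theta^{123}-d\theta^1\wedge(dx^{01}+dx^{23})-d\theta^2\wedge(dx^{02}+dx^{31})-d\theta^3\wedge(u\,dx^{03}+dx^{12})$ on $\mathbb T^7$, $u=u(x_0)$). Tangent vectors are smooth zero-mean functions $f$ on $S^1$. With $F(x)=\int_0^xf$, $Q(f)=F-\big[\int_{S^1}u^{-1}F\big]\big[\int_{S^1}u^{-1}\big]^{-1}$. The Dirichlet metric is $\mathcal G(f,g)=\int_{S^1}u^{-1}Q(f)Q(g)$, $\|f\|_{\mathcal G}^2=\mathcal G(f,f)$. $\mathrm{Vol}_\chi(u)=\int_{S^1}\chi(u)$,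 and $\mathcal E(u)=\int_{S^1}u^{-1}\tilde\tau^2$ with $\tilde\tau=\chi_{uu}u_xu$. *)

(* Defs.v *)
From Stdlib Require Import Reals.
From Coquelicot Require Import Coquelicot.
Open Scope R_scope.

(* Functions on S^1 = R/Z are represented by 1-periodic functions on R, and
   integrals over S^1 by integrals over [0,1]. *)

Definition interval (T : R -> Prop) : Prop :=
  (forall a b c : R, T a -> T b -> a <= c <= b -> T c) /\
  (exists a b : R, T a /\ T b /\ a < b).

Definition unit_interval (s : R) : Prop := 0 <= s <= 1.

(* [is_derive] with [locally x] replaced by its trace on [D]: one-sided at the
   endpoints of an interval, the usual derivative at its interior points. *)
Definition is_derive_in (D : R -> Prop) (f : R -> R) (x l : R) : Prop :=
  filterdiff f (within D (locally x)) (fun h : R => scal h l).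

(* C^k on A x R and on A x B x R, for nondegenerate intervals A and B: jointly
   continuous partial derivatives of all orders up to k, one-sided at the
   endpoints of A and B. *)
Fixpoint Ck2 (A : R -> Prop) (k : nat) (f : R -> R -> R) : Prop :=
  continuous_on (fun p : R * R => A (fst p)) (fun p : R * R => f (fst p) (snd p)) /\
  match k with
  | O => True
  | S k' =>
      exists ft fx : R -> R -> R,
        (forall t x : R, A t ->
           is_derive_in A (fun t' => f t' x) t (ft t x) /\
           is_derive (fun x' => f t x') x (fx t x)) /\
        Ck2 A k' ft /\ Ck2 A k' fx
  end.

Fixpoint Ck3 (A B : R -> Prop) (k : nat) (f : R -> R -> R -> R) : Prop :=
  continuous_on (fun p : R * R * R => A (fst (fst p)) /\ B (snd (fst p)))
    (fun p : R * R * R => f (fst (fst p)) (snd (fst p)) (snd p)) /\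
  match k with
  | O => True
  | S k' =>
      exists ft fs fx : R -> R -> R -> R,
        (forall t s x : R, A t -> B s ->
           is_derive_in A (fun t' => f t' s x) t (ft t s x) /\
           is_derive_in B (fun s' => f t s' x) s (fs t s x) /\
           is_derive (fun x' => f t s x') x (fx t s x)) /\
        Ck3 A B k' ft /\ Ck3 A B k' fs /\ Ck3 A B k' fx
  end.

Definition smooth2 (A : R -> Prop) (f : R -> R -> R) : Prop :=
  forall k : nat, Ck2 A k f.

Definition smooth3 (A B : R -> Prop) (f : R -> R -> R -> R) : Prop :=
  forall k : nat, Ck3 A B k f.

Definition smooth_pos (chi : R -> R) : Prop :=
  forall (n : nat) (y : R), 0 < y -> ex_derive_n chi n y.

Definition concave_pos (chi : R -> R) : Prop :=
  forall y z l : R, 0 < y -> 0 < z -> 0 <= l <= 1 ->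
    l * chi y + (1 - l) * chi z <= chi (l * y + (1 - l) * z).

Definition M1 (v : R -> R) : Prop :=
  (forall (n : nat) (x : R), ex_derive_n v n x) /\
  (forall x : R, v (x + 1) = v x) /\
  (forall x : R, 0 < v x) /\
  RInt v 0 1 = 1.

Definition primitive (f : R -> R) (x : R) : R := RInt f 0 x.

Definition Q (v f : R -> R) (x : R) : R :=
  primitive f x
  - RInt (fun y => / v y * primitive f y) 0 1 * / RInt (fun y => / v y) 0 1.

Definition G (v f g : R -> R) : R :=
  RInt (fun x => / v x * Q v f x * Q v g x) 0 1.

Definition normG2 (v f : R -> R) : R := G v f f.

Definition chi_uu (chi : R -> R) (y : R) : R := Derive_n chi 2 y.

Definition tau (chi v : R -> R) (x : R) : R :=
  chi_uu chi (v x) * Derive v x * v x.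

Definition Vol (chi v : R -> R) : R := RInt (fun x => chi (v x)) 0 1.

Definition E (chi v : R -> R) : R := RInt (fun x => / v x * (tau chi v x) ^ 2) 0 1.

Definition K (v f : R -> R) (x : R) : R := f x - Q v f x * Derive v x / v x.

Definition chi_flow (chi : R -> R) (T : R -> Prop) (u : R -> R -> R) : Prop :=
  forall t x : R, T t ->
    is_derive_in T (fun t' => u t' x) t (- Derive (tau chi (u t)) x).

(* Main.v *)
(* With f = u_s, q = Q(f) (so q_x = f and q/u has zero mean) and z = d/ds tau, the flow gives
   u_t = - tau_x and f_t = - z_x, hence q_t = - z up to a constant in x, which is killed by the
   zero mean of q/u.  Thus the t-derivative of the integral of q^2/u is that of
   - 2 q z / u + q^2 tau_x / u^2, and this integrand differs from 2 chi'' K(f)^2 by an exact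
   x-derivative of a periodic function.  Along the flow itself tau/u = (chi' o u)_x has zero
   mean, so Q(u_t) = - tau; hence E(u) is the squared norm of u_t and the second claim follows
   from the same computation with s replaced by t.  *)

Require Import Defs.
From Stdlib Require Import Reals Lra ClassicalEpsilon FunctionalExtensionality.
From Coquelicot Require Import Coquelicot.
Open Scope R_scope.

(** * One-sided derivatives *)

(** The overview differentiates freely; three obstacles shape the proof. First, derivatives in [t]
    and [s] are relative to an interval and may be one-sided. Two-sided calculus is reached through
    extensions: a tangent line off the domain for the pointwise rules, an affine continuation beyond
    a compact subinterval for integrals with a parameter. Second, [f_t = - z_x] exchanges [t] with
    [s], whereas [Ck3] asserts existence and continuity of iterated partials but not their symmetry;
    the exchange is obtained by integrating in one of the variables and differentiating under the
    integral. Third, [Q] contains a quotient of integrals that moves with [t]. Writing the squared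
    norm as [N - J^2 / I] leaves three integrals to differentiate, and because [N - 2 c J + c^2 I]
    is stationary in [c] at [c = J / I], the constant inside [Q] may be treated as frozen. *)

Lemma is_derive_in_eps (D : R -> Prop) (f : R -> R) (x l : R) : D x ->
  is_derive_in D f x l <->
  (forall eps : posreal, exists delta : posreal, forall y : R, D y ->
     Rabs (y - x) < delta ->
     Rabs (f y - f x - (y - x) * l) <= eps * Rabs (y - x)).
Proof.
  intros Dx; split.
  - intros [_ H] eps.
    assert (Hx : is_filter_lim (within D (locally x)) x).
    { intros P [d HP]; exists d; intros y Hy _; exact (HP y Hy). }
    destruct (H x Hx eps) as [d Hd]; exists d; intros y Dy Hy.
    exact (Hd y Hy Dy).
  - intros H; split.
    + exact (is_linear_scal_l (K := R_AbsRing) (V := R_NormedModule) l).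
    + assert (FF : ProperFilter' (within D (locally x))).
      { constructor; [|apply within_filter, locally_filter].
        intros [d Hd]; exact (Hd x (ball_center x d) Dx). }
      intros x' Hx' eps.
      assert (Hx : is_filter_lim (within D (locally x)) x).
      { intros P [d HP]; exists d; intros y Hy _; exact (HP y Hy). }
      assert (E := is_filter_lim_unique (K := R_AbsRing) (V := R_NormedModule)
                     (FF := FF) x' x Hx' Hx).
      subst x'.
      destruct (H eps) as [d Hd]; exists d; intros y Hy Dy.
      exact (Hd y Dy Hy).
Qed.

Lemma is_derive_in_True (f : R -> R) (x l : R) :
  is_derive_in (fun _ => True) f x l <-> is_derive f x l.
Proof.
  assert (W : forall (y : R) (P : R -> Prop),
    within (fun _ : R => True) (locally y) P <-> locally y P).
  { intros y P; split; intros [d Hd]; exists d; intros z Hz; [|intros _];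
      apply Hd; auto. }
  split; intros [Hl H]; split; try exact Hl;
    intros x' Hx' eps; apply W; apply H; intros P HP; apply W; auto.
Qed.

Lemma is_derive_is_derive_in (D : R -> Prop) (f : R -> R) (x l : R) : D x ->
  is_derive f x l -> is_derive_in D f x l.
Proof.
  intros Dx H; apply is_derive_in_True in H.
  rewrite (is_derive_in_eps _ _ _ _ I) in H.
  apply is_derive_in_eps; [exact Dx|]; intros eps.
  destruct (H eps) as [d Hd]; exists d; intros y _; apply Hd; exact I.
Qed.

Lemma is_derive_in_local (D D' : R -> Prop) (f g : R -> R) (x l : R) (d : posreal) :
  D x -> D' x ->
  (forall y, D' y -> Rabs (y - x) < d -> D y /\ g y = f y) ->
  is_derive_in D f x l -> is_derive_in D' g x l.
Proof.
  intros Dx Dx' E H; rewrite (is_derive_in_eps _ _ _ _ Dx) in H.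
  apply is_derive_in_eps; [exact Dx'|]; intros eps.
  destruct (H eps) as [d' Hd'].
  assert (Hm : 0 < Rmin d d') by (apply Rmin_pos; apply cond_pos).
  exists (mkposreal _ Hm); intros y Dy Hy; simpl in Hy.
  assert (Hy1 : Rabs (y - x) < d) by (apply Rlt_le_trans with (1 := Hy), Rmin_l).
  assert (Hy2 : Rabs (y - x) < d') by (apply Rlt_le_trans with (1 := Hy), Rmin_r).
  destruct (E y Dy Hy1) as [Ty ->].
  assert (H0 : Rabs (x - x) < d)
    by (replace (x - x) with 0 by ring; rewrite Rabs_R0; apply cond_pos).
  destruct (E x Dx' H0) as [_ ->].
  exact (Hd' y Ty Hy2).
Qed.

Lemma is_derive_in_ext (D : R -> Prop) (f g : R -> R) (x l : R) :
  D x -> (forall y, D y -> f y = g y) ->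
  is_derive_in D f x l -> is_derive_in D g x l.
Proof.
  intros Dx E; apply is_derive_in_local with (d := mkposreal 1 Rlt_0_1); auto.
  intros y Dy _; split; [exact Dy|symmetry; auto].
Qed.

(** Off [D] the function is replaced by its candidate tangent line at [x], whose first-order error
    is zero. The sum, product and chain rules for one-sided derivatives then follow from the
    two-sided ones. *)
Lemma is_derive_in_extension (D : R -> Prop) (f : R -> R) (x l : R) : D x ->
  is_derive_in D f x l ->
  exists g : R -> R, is_derive g x l /\ forall y, D y -> g y = f y.
Proof.
  intros Dx H.
  exists (fun y => if excluded_middle_informative (D y)
                   then f y else f x + (y - x) * l).
  split.
  - apply is_derive_in_True, is_derive_in_eps; [exact I|]; intros eps.
    rewrite (is_derive_in_eps _ _ _ _ Dx) in H.
    destruct (H eps) as [d Hd]; exists d; intros y _ Hy.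
    destruct (excluded_middle_informative (D x)) as [_|n]; [|tauto].
    destruct (excluded_middle_informative (D y)) as [Dy|_]; [auto|].
    replace (_ - _ - _) with 0 by ring; rewrite Rabs_R0.
    apply Rmult_le_pos; [apply Rlt_le, cond_pos|apply Rabs_pos].
  - intros y Dy; destruct (excluded_middle_informative (D y)); tauto.
Qed.

Lemma is_derive_in_plus (D : R -> Prop) (f g : R -> R) (x lf lg : R) : D x ->
  is_derive_in D f x lf -> is_derive_in D g x lg ->
  is_derive_in D (fun y => f y + g y) x (lf + lg).
Proof.
  intros Dx Hf Hg.
  destruct (is_derive_in_extension _ _ _ _ Dx Hf) as [F [HF EF]].
  destruct (is_derive_in_extension _ _ _ _ Dx Hg) as [G [HG EG]].
  apply is_derive_in_ext with (fun y => F y + G y); [exact Dx| |].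
  - intros y Dy; rewrite EF, EG; auto.
  - apply is_derive_is_derive_in; [exact Dx|].
    exact (is_derive_plus F G x lf lg HF HG).
Qed.

Lemma is_derive_in_mult (D : R -> Prop) (f g : R -> R) (x lf lg : R) : D x ->
  is_derive_in D f x lf -> is_derive_in D g x lg ->
  is_derive_in D (fun y => f y * g y) x (lf * g x + f x * lg).
Proof.
  intros Dx Hf Hg.
  destruct (is_derive_in_extension _ _ _ _ Dx Hf) as [F [HF EF]].
  destruct (is_derive_in_extension _ _ _ _ Dx Hg) as [G [HG EG]].
  apply is_derive_in_ext with (fun y => F y * G y); [exact Dx| |].
  - intros y Dy; rewrite EF, EG; auto.
  - apply is_derive_is_derive_in; [exact Dx|].
    rewrite <- (EF x Dx), <- (EG x Dx).
    exact (is_derive_mult F G x lf lg HF HG Rmult_comm).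
Qed.

Lemma is_derive_in_comp (D : R -> Prop) (h f : R -> R) (x lf lh : R) : D x ->
  is_derive_in D f x lf -> is_derive h (f x) lh ->
  is_derive_in D (fun y => h (f y)) x (lf * lh).
Proof.
  intros Dx Hf Hh.
  destruct (is_derive_in_extension _ _ _ _ Dx Hf) as [F [HF EF]].
  apply is_derive_in_ext with (fun y => h (F y)); [exact Dx| |].
  - intros y Dy; rewrite EF; auto.
  - apply is_derive_is_derive_in; [exact Dx|].
    rewrite <- (EF x Dx) in Hh.
    exact (is_derive_comp h F x lh lf Hh HF).
Qed.

Lemma is_derive_in_const (D : R -> Prop) (c x : R) : D x ->
  is_derive_in D (fun _ => c) x 0.
Proof.
  intros Dx; apply is_derive_is_derive_in; [exact Dx|].
  exact (is_derive_const c x).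
Qed.

Lemma is_derive_in_inv (D : R -> Prop) (f : R -> R) (x lf : R) : D x ->
  f x <> 0 -> is_derive_in D f x lf ->
  is_derive_in D (fun y => / f y) x (- lf / f x ^ 2).
Proof.
  intros Dx Hx Hf.
  replace (- lf / f x ^ 2) with (lf * (- 1 / f x ^ 2)) by (unfold Rdiv; ring).
  apply is_derive_in_comp; [exact Dx|exact Hf|].
  exact (is_derive_inv (fun y => y) (f x) 1 (is_derive_id (f x)) Hx).
Qed.

Lemma is_derive_in_continuous (D : R -> Prop) (f : R -> R) (x l : R) : D x ->
  is_derive_in D f x l -> filterlim f (within D (locally x)) (locally (f x)).
Proof.
  intros Dx H.
  destruct (is_derive_in_extension _ _ _ _ Dx H) as [g [Hg E]].
  rewrite <- (E x Dx).
  assert (C : filterlim g (locally x) (locally (g x))).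
  { apply (ex_derive_continuous g x); exists l; exact Hg. }
  intros P HP; generalize (C P HP); unfold within, filtermap.
  apply filter_imp; intros y Hy Dy; rewrite <- (E y Dy); exact Hy.
Qed.

(** Nondegeneracy makes every point of [T] an accumulation point of [T], which is what uniqueness of
    a one-sided derivative requires. *)
Lemma interval_neighbour (T : R -> Prop) (x : R) (d : posreal) :
  interval T -> T x -> exists y, T y /\ y <> x /\ Rabs (y - x) < d.
Proof.
  intros [Conv [a [b [Ta [Tb ab]]]]] Tx; assert (d0 := cond_pos d).
  destruct (Rlt_le_dec x b) as [Hb|Hb].
  - assert (m0 : 0 < Rmin (d / 2) (b - x)) by (apply Rmin_pos; lra).
    assert (m1 := Rmin_l (d / 2) (b - x)).
    assert (m2 := Rmin_r (d / 2) (b - x)).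
    exists (x + Rmin (d / 2) (b - x)); split; [|split]; [|lra|].
    + apply (Conv x b); auto; lra.
    + rewrite Rabs_right; lra.
  - assert (m0 : 0 < Rmin (d / 2) (x - a)) by (apply Rmin_pos; lra).
    assert (m1 := Rmin_l (d / 2) (x - a)).
    assert (m2 := Rmin_r (d / 2) (x - a)).
    exists (x - Rmin (d / 2) (x - a)); split; [|split]; [|lra|].
    + apply (Conv a x); auto; lra.
    + rewrite Rabs_left; lra.
Qed.

(** The tool for identifying two expressions of one derivative: a velocity named in a hypothesis
    with the partial supplied by smoothness, or the two sides of an identity differentiated in
    different ways. *)
Lemma is_derive_in_unique (T : R -> Prop) (f : R -> R) (x l l' : R) :
  interval T -> T x ->
  is_derive_in T f x l -> is_derive_in T f x l' -> l = l'.
Proof.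
  intros IT Tx H H'.
  rewrite (is_derive_in_eps _ _ _ _ Tx) in H.
  rewrite (is_derive_in_eps _ _ _ _ Tx) in H'.
  destruct (Req_dec l l') as [E|N]; [exact E|exfalso].
  (* With a third of the gap for each derivative, the two errors add up to at most two thirds of
     [|l - l'| |y - x|], too little to account for [(y - x) (l - l')]. *)
  assert (e0 : 0 < Rabs (l - l') / 3).
  { apply Rdiv_lt_0_compat; [apply Rabs_pos_lt; lra|lra]. }
  destruct (H (mkposreal _ e0)) as [d Hd], (H' (mkposreal _ e0)) as [d' Hd'].
  simpl in Hd, Hd'.
  assert (Hm : 0 < Rmin d d') by (apply Rmin_pos; apply cond_pos).
  destruct (interval_neighbour T x (mkposreal _ Hm) IT Tx) as [y [Ty [Ny Hy]]].
  simpl in Hy.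
  assert (A := Hd y Ty (Rlt_le_trans _ _ _ Hy (Rmin_l _ _))).
  assert (A' := Hd' y Ty (Rlt_le_trans _ _ _ Hy (Rmin_r _ _))).
  assert (P : 0 < Rabs (y - x)) by (apply Rabs_pos_lt; lra).
  assert (B : Rabs ((y - x) * (l - l')) <=
              Rabs (f y - f x - (y - x) * l') + Rabs (f y - f x - (y - x) * l)).
  { replace ((y - x) * (l - l')) with
      ((f y - f x - (y - x) * l') - (f y - f x - (y - x) * l)) by ring.
    apply Rle_trans with (1 := Rabs_triang _ _); rewrite Rabs_Ropp; lra. }
  rewrite Rabs_mult in B; nra.
Qed.

Lemma interval_True : interval (fun _ => True).
Proof. split; [auto|exists 0, 1; split; [auto|split; [auto|lra]]]. Qed.

Lemma interval_unit : interval unit_interval.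
Proof.
  unfold unit_interval; split; [intros; lra|exists 0, 1; lra].
Qed.

(** * Continuity on a domain *)

Section ContinuousOn.
Context {U : UniformSpace} (D : U -> Prop).

Lemma continuous_on_plus (f g : U -> R) :
  continuous_on D f -> continuous_on D g -> continuous_on D (fun p => f p + g p).
Proof.
  intros Hf Hg p Dp.
  exact (filterlim_comp_2 _ _ Rplus (Hf p Dp) (Hg p Dp)
           (filterlim_plus (K := R_AbsRing) (V := R_NormedModule) (f p) (g p))).
Qed.

Lemma continuous_on_mult (f g : U -> R) :
  continuous_on D f -> continuous_on D g -> continuous_on D (fun p => f p * g p).
Proof.
  intros Hf Hg p Dp.
  exact (filterlim_comp_2 _ _ Rmult (Hf p Dp) (Hg p Dp)
           (filterlim_mult (K := R_AbsRing) (f p) (g p))).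
Qed.

Lemma continuous_on_const (c : R) : continuous_on D (fun _ => c).
Proof. intros p _; apply filterlim_const. Qed.

Lemma continuous_on_comp {V W : UniformSpace} (D' : V -> Prop) (f : V -> W) (g : U -> V) :
  (forall p, D p -> D' (g p)) -> continuous_on D g -> continuous_on D' f ->
  continuous_on D (fun p => f (g p)).
Proof.
  intros HD Hg Hf p Dp.
  apply filterlim_comp with (within D' (locally (g p))); [|apply Hf; auto].
  intros P HP; generalize (Hg p Dp _ HP); unfold filtermap, within.
  apply filter_imp; intros q Hq Dq; apply Hq; auto.
Qed.

Lemma continuous_on_opp (f : U -> R) :
  continuous_on D f -> continuous_on D (fun p => - f p).
Proof.
  intros Hf; apply continuous_on_ext with (fun p => -1 * f p).
  - intros p _; change (-1 * f p = - f p); ring.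
  - apply continuous_on_mult; [apply continuous_on_const|exact Hf].
Qed.

Lemma continuous_on_comp_continuous (h : R -> R) (f : U -> R) :
  (forall p, D p -> continuous h (f p)) -> continuous_on D f ->
  continuous_on D (fun p => h (f p)).
Proof.
  intros Hh Hf p Dp; exact (filterlim_comp _ _ _ _ _ _ _ _ (Hf p Dp) (Hh p Dp)).
Qed.

Lemma continuous_on_inv (f : U -> R) :
  (forall p, D p -> f p <> 0) -> continuous_on D f ->
  continuous_on D (fun p => / f p).
Proof.
  intros Hf; apply continuous_on_comp_continuous.
  intros p Dp; apply continuous_Rinv; auto.
Qed.

End ContinuousOn.

Lemma continuous_on_pair {U V W : UniformSpace} (D : U -> Prop) (f : U -> V) (g : U -> W) :
  continuous_on D f -> continuous_on D g -> continuous_on D (fun p => (f p, g p)).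
Proof.
  intros Hf Hg p Dp P [d HP].
  assert (A := Hf p Dp _ (locally_ball (f p) d)).
  assert (B := Hg p Dp _ (locally_ball (g p) d)).
  unfold filtermap, within in *.
  apply filter_imp with (2 := filter_and _ _ A B); intros q [Aq Bq] Dq.
  apply HP; split; simpl; auto.
Qed.

Lemma continuous_on_continuous {U V : UniformSpace} (D : U -> Prop) (f : U -> V) :
  (forall p, D p -> continuous f p) -> continuous_on D f.
Proof. intros H; apply continuous_on_forall; exact H. Qed.

Lemma continuous_on_True {U V : UniformSpace} (f : U -> V) (p : U) :
  continuous_on (fun _ => True) f -> continuous f p.
Proof.
  intros H P HP; generalize (H p I P HP); unfold filtermap, within.
  apply filter_imp; auto.
Qed.

Definition strip (T : R -> Prop) (p : R * R) : Prop := T (fst p).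

Definition uncurry2 (f : R -> R -> R) (p : R * R) : R := f (fst p) (snd p).

Lemma continuous_strip_section (T : R -> Prop) (f : R -> R -> R) (t x : R) :
  continuous_on (strip T) (uncurry2 f) -> T t -> continuous (f t) x.
Proof.
  intros H Tt; apply continuous_on_True.
  apply (continuous_on_comp (fun _ : R => True) (strip T) (uncurry2 f) (fun y => (t, y))).
  - intros; exact Tt.
  - apply continuous_on_pair; [apply continuous_on_continuous; intros; apply continuous_const|].
    apply continuous_on_continuous; intros; apply continuous_id.
  - exact H.
Qed.

Lemma continuous_on_strip_slice (T : R -> Prop) (f : R -> R -> R) (x : R) :
  continuous_on (strip T) (uncurry2 f) -> continuous_on T (fun t => f t x).
Proof.
  intros H.
  apply (continuous_on_comp T (strip T) (uncurry2 f) (fun y => (y, x))).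
  - intros; assumption.
  - apply continuous_on_pair; apply continuous_on_continuous; intros;
      [apply continuous_id|apply continuous_const].
  - exact H.
Qed.

(** For [c <= d] this is the continuous retraction of the line onto [[c,d]]; composing with it turns
    a function known only on [T] into one defined and continuous everywhere. *)
Definition clamp (c d x : R) : R := Rmax c (Rmin d x).

Lemma clamp_bounds (c d x : R) : c <= d -> c <= clamp c d x <= d.
Proof.
  intros H; unfold clamp, Rmax, Rmin.
  destruct (Rle_dec d x), (Rle_dec c _); lra.
Qed.

Lemma clamp_id (c d x : R) : c <= x <= d -> clamp c d x = x.
Proof.
  intros H; unfold clamp, Rmax, Rmin.
  destruct (Rle_dec d x), (Rle_dec c _); lra.
Qed.

(* Equality in the triangle inequality: [clamp c d y] lies between [p] and [y]. *)
Lemma clamp_between (c d p y : R) : c <= p <= d ->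
  Rabs (clamp c d y - p) + Rabs (y - clamp c d y) = Rabs (y - p).
Proof.
  intros H; unfold clamp, Rmax, Rmin.
  destruct (Rle_dec d y), (Rle_dec c _); unfold Rabs;
    repeat destruct Rcase_abs; lra.
Qed.

Lemma continuous_clamp (c d x : R) : continuous (clamp c d) x.
Proof.
  intros P [eps HP]; exists eps; intros y Hy; apply HP.
  apply Rle_lt_trans with (2 := Hy).
  change (Rabs (clamp c d y - clamp c d x) <= Rabs (y - x)).
  unfold clamp, Rmax, Rmin.
  destruct (Rle_dec d x), (Rle_dec d y);
    repeat destruct (Rle_dec c _); unfold Rabs; repeat destruct Rcase_abs; lra.
Qed.

(** [T] may be open, closed, half-open or unbounded. A point of [T] on either side of [t] serves as
    [c] or [d]; if a side has none, [t] is an endpoint of [T] and is itself taken as the bound. So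
    [[c,d]] is always a neighbourhood of [t] relative to [T]. *)
Lemma interval_compact_neighbourhood (T : R -> Prop) (t : R) :
  interval T -> T t -> exists (c d : R) (e : posreal),
    c <= t <= d /\ (forall y, c <= y <= d -> T y) /\
    (forall y, T y -> Rabs (y - t) < e -> c <= y <= d).
Proof.
  intros [Conv _] Tt.
  assert (L : exists (c : R) (e : posreal), T c /\ c <= t /\
              forall y, T y -> Rabs (y - t) < e -> c <= y).
  { destruct (excluded_middle_informative (exists c, T c /\ c < t)) as [[c [Tc Hc]]|N].
    - assert (P : 0 < t - c) by lra.
      exists c, (mkposreal _ P); split; [exact Tc|split; [lra|]].
      intros y _ Hy; apply Rabs_def2 in Hy; simpl in Hy; lra.
    - exists t, (mkposreal 1 Rlt_0_1); split; [exact Tt|split; [lra|]].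
      intros y Ty _; apply Rnot_lt_le; intros Hy; apply N; exists y; auto. }
  assert (U : exists (d : R) (e : posreal), T d /\ t <= d /\
              forall y, T y -> Rabs (y - t) < e -> y <= d).
  { destruct (excluded_middle_informative (exists d, T d /\ t < d)) as [[d [Td Hd]]|N].
    - assert (P : 0 < d - t) by lra.
      exists d, (mkposreal _ P); split; [exact Td|split; [lra|]].
      intros y _ Hy; apply Rabs_def2 in Hy; simpl in Hy; lra.
    - exists t, (mkposreal 1 Rlt_0_1); split; [exact Tt|split; [lra|]].
      intros y Ty _; apply Rnot_lt_le; intros Hy; apply N; exists y; auto. }
  destruct L as [c [e [Tc [Hc He]]]], U as [d [e' [Td [Hd He']]]].
  assert (P : 0 < Rmin e e') by (apply Rmin_pos; apply cond_pos).
  exists c, d, (mkposreal _ P); split; [lra|split].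
  - intros y Hy; exact (Conv c d y Tc Td Hy).
  - intros y Ty Hy; simpl in Hy; split.
    + apply He; [exact Ty|apply Rlt_le_trans with (1 := Hy), Rmin_l].
    + apply He'; [exact Ty|apply Rlt_le_trans with (1 := Hy), Rmin_r].
Qed.

(** * Differentiation under the integral and mixed partials *)

(* Affine continuation beyond [[c,d]] turns one-sided derivatives into two-sided ones,
   which is what Coquelicot's theorems about integrals require. *)
Definition affine_continuation (c d : R) (f f' : R -> R) (y : R) : R :=
  f (clamp c d y) + (y - clamp c d y) * f' (clamp c d y).

Lemma affine_continuation_id (c d : R) (f f' : R -> R) (y : R) :
  c <= y <= d -> affine_continuation c d f f' y = f y.
Proof. intros H; unfold affine_continuation; rewrite clamp_id by exact H; ring. Qed.

Lemma is_derive_affine_continuation (T : R -> Prop) (f f' : R -> R) (c d y : R) :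
  c <= d -> (forall z, c <= z <= d -> T z) ->
  (forall z, T z -> is_derive_in T f z (f' z)) -> continuous_on T f' ->
  is_derive (affine_continuation c d f f') y (f' (clamp c d y)).
Proof.
  intros cd HT Hf Cf'.
  (* Outside [[c,d]] the clamp is locally constant, so the continuation coincides there with the
     tangent line at the endpoint [p]. *)
  assert (Outer : forall p,
    (exists e : posreal, forall z, Rabs (z - y) < e -> clamp c d z = p) ->
    is_derive (affine_continuation c d f f') y (f' (clamp c d y))).
  { intros p [e He].
    apply is_derive_ext_loc with (fun z => f p + (z - p) * f' p).
    - exists e; intros z Hz; unfold affine_continuation; rewrite (He z Hz); reflexivity.
    - rewrite He by (rewrite Rminus_diag, Rabs_R0; apply cond_pos).
      auto_derive; [exact I|ring]. }
  destruct (Rlt_le_dec y c) as [yc|cy]; [|destruct (Rlt_le_dec d y) as [dy|yd]].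
  - assert (K : forall z, z < c -> clamp c d z = c).
    { intros z Hz; unfold clamp, Rmax, Rmin.
      destruct (Rle_dec d z), (Rle_dec c _); lra. }
    apply (Outer c).
    assert (P : 0 < c - y) by lra.
    exists (mkposreal _ P); intros z Hz; apply K.
    apply Rabs_def2 in Hz; simpl in Hz; lra.
  - assert (K : forall z, d < z -> clamp c d z = d).
    { intros z Hz; unfold clamp, Rmax, Rmin.
      destruct (Rle_dec d z), (Rle_dec c _); lra. }
    apply (Outer d).
    assert (P : 0 < y - d) by lra.
    exists (mkposreal _ P); intros z Hz; apply K.
    apply Rabs_def2 in Hz; simpl in Hz; lra.
  - assert (Hy : c <= y <= d) by lra; assert (Ty := HT y Hy).
    rewrite clamp_id by exact Hy.
    apply is_derive_in_True, is_derive_in_eps; [exact I|]; intros eps.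
    assert (D := Hf y Ty); rewrite (is_derive_in_eps _ _ _ _ Ty) in D.
    destruct (D eps) as [d1 H1].
    destruct (Cf' y Ty _ (locally_ball (f' y) eps)) as [d2 H2].
    assert (P : 0 < Rmin d1 d2) by (apply Rmin_pos; apply cond_pos).
    exists (mkposreal _ P); intros z _ Hz; simpl in Hz.
    assert (B := clamp_between c d y z Hy).
    rewrite (affine_continuation_id c d f f' y Hy); unfold affine_continuation.
    set (k := clamp c d z) in *.
    assert (Tk : T k) by (apply HT, clamp_bounds, cd).
    assert (Z1 := Rabs_pos (k - y)); assert (Z2 := Rabs_pos (z - k)).
    assert (M1 := Rmin_l d1 d2); assert (M2 := Rmin_r d1 d2).
    assert (A1 : Rabs (f k - f y - (k - y) * f' y) <= eps * Rabs (k - y))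
      by (apply H1; [exact Tk|lra]).
    assert (A2 : Rabs (f' k - f' y) < eps).
    { apply H2; [|exact Tk]; change (Rabs (k - y) < d2); lra. }
    (* The increment from [y] to [k] costs [eps |k - y|] by one-sided differentiability, the change
       of slope over the rest costs [eps |z - k|] by continuity of [f'], and [B] says that the two
       lengths add up to [|z - y|]. *)
    replace (f k + (z - k) * f' k - f y - (z - y) * f' y) with
      ((f k - f y - (k - y) * f' y) + (z - k) * (f' k - f' y)) by ring.
    apply Rle_trans with (1 := Rabs_triang _ _); rewrite Rabs_mult, <- B.
    assert (Rabs (z - k) * Rabs (f' k - f' y) <= Rabs (z - k) * eps)
      by (apply Rmult_le_compat_l; lra).
    lra.
Qed.

(** For each [x] the function of [t] is continued affinely beyond a compact neighbourhood [[c,d]] of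
    [t] in [T]. The continued integrand [H] has the two-sided derivative [ht (clamp c d y) x],
    jointly continuous on the plane, so the classical theorem applies; near [t] the integrals of [H]
    and of [h] agree on [T]. *)
Lemma is_derive_in_RInt_param (T : R -> Prop) (h ht : R -> R -> R) (a b t : R) :
  interval T -> T t ->
  (forall t x, T t -> is_derive_in T (fun t' => h t' x) t (ht t x)) ->
  continuous_on (strip T) (uncurry2 ht) ->
  (forall t x, T t -> continuous (h t) x) ->
  is_derive_in T (fun t' => RInt (h t') a b) t (RInt (ht t) a b).
Proof.
  intros IT Tt Hh Cht Ch.
  destruct (interval_compact_neighbourhood T t IT Tt) as [c [d [e [Ht [HT He]]]]].
  assert (cd : c <= d) by lra.
  set (H := fun y x => affine_continuation c d (fun t => h t x) (fun t => ht t x) y).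
  assert (DH : forall y x, is_derive (fun y' => H y' x) y (ht (clamp c d y) x)).
  { intros y x; unfold H.
    apply (is_derive_affine_continuation T (fun t => h t x) (fun t => ht t x)); auto.
    exact (continuous_on_strip_slice T ht x Cht). }
  apply is_derive_in_local with (D := fun _ => True) (f := fun y => RInt (H y) a b) (d := e);
    auto.
  - intros y Ty Hy; split; [exact I|].
    apply RInt_ext; intros x _; symmetry.
    exact (affine_continuation_id c d _ _ y (He y Ty Hy)).
  - apply is_derive_in_True.
    replace (RInt (ht t) a b) with (RInt (fun x => Derive (fun y => H y x) t) a b).
    + apply is_derive_RInt_param.
      * exists e; intros y _ x _; exists (ht (clamp c d y) x); apply DH.
      * intros x _.
        apply continuity_2d_pt_ext with (fun u v => ht (clamp c d u) v).
        { intros u v; symmetry; apply is_derive_unique, DH. }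
        apply continuity_2d_pt_filterlim.
        change (continuous (fun p => uncurry2 ht (clamp c d (fst p), snd p)) (t, x)).
        apply continuous_on_True.
        apply (continuous_on_comp (fun _ => True) (strip T) (uncurry2 ht)
                 (fun p : R * R => (clamp c d (fst p), snd p))); [| |exact Cht].
        { intros p _; apply HT, clamp_bounds, cd. }
        apply continuous_on_pair; apply continuous_on_continuous; intros p _.
        -- apply (continuous_comp fst (clamp c d));
             [apply continuous_fst|apply continuous_clamp].
        -- apply continuous_snd.
      * exists e; intros y _; apply (ex_RInt_continuous (V := R_CompleteNormedModule)).
        intros x _; assert (Tk : T (clamp c d y)) by (apply HT, clamp_bounds, cd).
        apply (continuous_plus (h (clamp c d y))
                 (fun x => (y - clamp c d y) * ht (clamp c d y) x)); [auto|].
        apply (continuous_mult (fun _ => y - clamp c d y) (ht (clamp c d y)));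
          [apply continuous_const|].
        exact (continuous_strip_section T ht _ x Cht Tk).
    + apply RInt_ext; intros x _.
      etransitivity; [apply is_derive_unique, DH|].
      rewrite clamp_id by lra; reflexivity.
Qed.

(* Integrating [A] in the first variable recovers [fq p q - fq p0 q], so the mixed partial
   need not be assumed to exist in the other order. *)
Lemma mixed_partials (P Q : R -> Prop) (f fp fq A : R -> R -> R) :
  interval P -> interval Q ->
  (forall p q, P p -> Q q -> is_derive_in P (fun p' => f p' q) p (fp p q)) ->
  (forall p q, P p -> Q q -> is_derive_in Q (fun q' => f p q') q (fq p q)) ->
  (forall p q, P p -> Q q -> is_derive_in Q (fun q' => fp p q') q (A p q)) ->
  (forall q, Q q -> continuous_on P (fun p => fp p q)) ->
  continuous_on (fun z => P (fst z) /\ Q (snd z)) (uncurry2 A) ->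
  forall p q, P p -> Q q -> is_derive_in P (fun p' => fq p' q) p (A p q).
Proof.
  intros IP IQ Hp Hq HA Cp CA p q Pp Qq.
  destruct (interval_compact_neighbourhood P p IP Pp) as [c [d [e [Ht [HP He]]]]].
  assert (cd : c <= d) by lra.
  assert (HK : forall s, P (clamp c d s)) by (intros; apply HP, clamp_bounds, cd).
  assert (CK : forall (g : R -> R), continuous_on P g ->
               forall s, continuous (fun s => g (clamp c d s)) s).
  { intros g Cg s; apply continuous_on_True.
    apply (continuous_on_comp (fun _ : R => True) P g (clamp c d)); auto.
    apply continuous_on_continuous; intros; apply continuous_clamp. }
  assert (I1 : forall p' q, c <= p' <= d -> Q q ->
    RInt (fun s => fp (clamp c d s) q) p p' = f p' q - f p q).
  { intros p' q' Hp' Qq'; apply is_RInt_unique.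
    rewrite <- (affine_continuation_id c d (fun p => f p q') (fun p => fp p q') p' Hp').
    rewrite <- (affine_continuation_id c d (fun p => f p q') (fun p => fp p q') p Ht).
    apply (is_RInt_derive (V := R_CompleteNormedModule)
             (affine_continuation c d (fun p => f p q') (fun p => fp p q'))).
    - intros s _; apply (is_derive_affine_continuation P (fun p => f p q') (fun p => fp p q'));
        auto.
    - intros s _; apply (CK (fun p => fp p q')); auto. }
  (* Both sides are the [q]-derivative of [I1]: taken directly on one side, under the integral sign
     on the other. The fundamental theorem in [p'] then yields the claim. *)
  assert (I2 : forall p', c <= p' <= d ->
    fq p' q - fq p q = RInt (fun s => A (clamp c d s) q) p p').
  { intros p' Hp'.
    apply (is_derive_in_unique Q (fun q => f p' q - f p q) q); auto.
    - replace (fq p' q - fq p q) with (fq p' q + (0 * f p q + -1 * fq p q)) by ring.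
      apply is_derive_in_ext with (fun q => f p' q + -1 * f p q); [exact Qq|intros; ring|].
      apply is_derive_in_plus; auto.
      apply is_derive_in_mult; auto using is_derive_in_const.
    - apply is_derive_in_ext with
        (fun q => RInt ((fun q s => fp (clamp c d s) q) q) p p'); auto.
      apply (is_derive_in_RInt_param Q (fun q s => fp (clamp c d s) q)
               (fun q s => A (clamp c d s) q)); auto.
      + apply (continuous_on_comp (strip Q) (fun z => P (fst z) /\ Q (snd z)) (uncurry2 A)
                 (fun z : R * R => (clamp c d (snd z), fst z))); [| |exact CA].
        { intros z Qz; split; [apply HK|exact Qz]. }
        apply continuous_on_pair; apply continuous_on_continuous; intros z _.
        * apply (continuous_comp snd (clamp c d));
            [apply continuous_snd|apply continuous_clamp].
        * apply continuous_fst.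
      + intros q' s Qq'; apply (CK (fun p => fp p q')); auto. }
  assert (CA' : continuous_on P (fun p => A p q)).
  { apply (continuous_on_comp P (fun z => P (fst z) /\ Q (snd z)) (uncurry2 A)
             (fun p => (p, q))); auto.
    apply continuous_on_pair; apply continuous_on_continuous; intros;
      [apply continuous_id|apply continuous_const]. }
  apply is_derive_in_local with (D := fun _ => True) (d := e)
    (f := fun p' => fq p q + RInt (fun s => A (clamp c d s) q) p p'); auto.
  - intros p' Pp' Hp'; split; [exact I|]; rewrite <- I2 by (apply He; auto); ring.
  - replace (A p q) with (0 + A (clamp c d p) q) by (rewrite clamp_id by lra; ring).
    apply is_derive_in_plus; auto using is_derive_in_const.
    apply is_derive_in_True.
    apply (is_derive_RInt (V := R_NormedModule) (fun s => A (clamp c d s) q) _ p).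
    + exists (mkposreal 1 Rlt_0_1); intros y _; apply (RInt_correct (V := R_CompleteNormedModule)).
      apply (ex_RInt_continuous (V := R_CompleteNormedModule)); intros s _.
      apply (CK (fun p => A p q)); exact CA'.
    + apply (CK (fun p => A p q)); exact CA'.
Qed.

(** A jointly continuous [x]-derivative is locally bounded, so [f] is Lipschitz in [x] uniformly for
    nearby [t]; continuity in [t] at a fixed [x] then upgrades to joint continuity. This serves
    primitives in [x], for which joint continuity is not among the data. *)
Lemma continuous_on_strip_of_partial (T : R -> Prop) (f g : R -> R -> R) :
  (forall t x, T t -> is_derive (f t) x (g t x)) ->
  continuous_on (strip T) (uncurry2 g) ->
  (forall x, continuous_on T (fun t => f t x)) ->
  continuous_on (strip T) (uncurry2 f).
Proof.
  intros Df Cg Cf [t x] Tt; unfold strip in Tt; simpl in Tt.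
  apply filterlim_locally; intros eps; unfold within, uncurry2; simpl.
  destruct (Cg (t, x) Tt _ (locally_ball _ (mkposreal 1 Rlt_0_1))) as [d1 H1].
  assert (e2 : 0 < eps / 2) by (assert (e := cond_pos eps); lra).
  destruct (Cf x t Tt _ (locally_ball _ (mkposreal _ e2))) as [d2 H2].
  (* [M] bounds the slope on the neighbourhood where [g] moves by less than 1. The radius
     [eps / 2 / M] makes the variation in [x] less than [eps / 2], the variation in [t] taking the
     other half. *)
  set (M := Rabs (g t x) + 1).
  assert (M0 : 0 < M) by (unfold M; assert (K := Rabs_pos (g t x)); lra).
  assert (e3 : 0 < eps / 2 / M) by (apply Rdiv_lt_0_compat; lra).
  assert (P : 0 < Rmin (Rmin d1 d2) (eps / 2 / M))
    by (repeat apply Rmin_pos; auto using cond_pos).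
  exists (mkposreal _ P); intros [t' x'] [Bt Bx] Tt'; unfold strip in Tt'.
  simpl in Bt, Bx, Tt' |- *.
  change (Rabs (t' - t) < Rmin (Rmin d1 d2) (eps / 2 / M)) in Bt.
  change (Rabs (x' - x) < Rmin (Rmin d1 d2) (eps / 2 / M)) in Bx.
  assert (m1 := Rmin_l (Rmin d1 d2) (eps / 2 / M)).
  assert (m2 := Rmin_r (Rmin d1 d2) (eps / 2 / M)).
  assert (m3 := Rmin_l d1 d2); assert (m4 := Rmin_r d1 d2).
  assert (A2 : Rabs (f t' x - f t x) < eps / 2)
    by (apply (H2 t'); [change (Rabs (t' - t) < d2); lra|exact Tt']).
  destruct (MVT_gen (f t') x x' (g t')) as [z [Hz E]].
  - intros; apply Df, Tt'.
  - intros z _; apply continuity_pt_filterlim.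
    apply (ex_derive_continuous (f t') z); exists (g t' z); apply Df, Tt'.
  - assert (Bz : Rabs (z - x) <= Rabs (x' - x)).
    { revert Hz; unfold Rmin, Rmax; destruct (Rle_dec x x'); intros;
        unfold Rabs; repeat destruct Rcase_abs; lra. }
    assert (A1 : Rabs (g t' z - g t x) < 1).
    { apply (H1 (t', z)); [|exact Tt'].
      split; [change (Rabs (t' - t) < d1)|change (Rabs (z - x) < d1)]; lra. }
    assert (Gz : Rabs (g t' z) <= M).
    { unfold M; replace (g t' z) with (g t x + (g t' z - g t x)) by ring.
      apply Rle_trans with (1 := Rabs_triang _ _); lra. }
    assert (A3 : Rabs (g t' z) * Rabs (x' - x) < eps / 2).
    { apply Rle_lt_trans with (M * Rabs (x' - x)).
      - apply Rmult_le_compat_r; [apply Rabs_pos|exact Gz].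
      - replace (eps / 2) with (M * (eps / 2 / M)) by (field; lra).
        apply Rmult_lt_compat_l; lra. }
    rewrite <- Rabs_mult, <- E in A3.
    change (Rabs (f t' x' - f t x) < eps).
    replace (f t' x' - f t x) with ((f t' x' - f t' x) + (f t' x - f t x)) by ring.
    apply Rle_lt_trans with (1 := Rabs_triang _ _); lra.
Qed.

(** * The flux and its derivatives *)

Lemma is_derive_in_eq (D : R -> Prop) (f : R -> R) (x l l' : R) :
  is_derive_in D f x l -> l = l' -> is_derive_in D f x l'.
Proof. intros H <-; exact H. Qed.

Lemma is_derive_Derive_n (chi : R -> R) (n : nat) (y : R) : smooth_pos chi -> 0 < y ->
  is_derive (Derive_n chi n) y (Derive_n chi (S n) y).
Proof. intros H Hy; apply Derive_correct; exact (H (S n) y Hy). Qed.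

Lemma continuous_Derive_n (chi : R -> R) (n : nat) (y : R) : smooth_pos chi -> 0 < y ->
  continuous (Derive_n chi n) y.
Proof.
  intros H Hy; apply (ex_derive_continuous (Derive_n chi n) y); exact (H (S n) y Hy).
Qed.

(** If [chi''] were positive at [y], it would be positive on [[y - h, y + h]] and [chi'] would
    increase there. The mean slope [chi' z1] to the right of [y] would then exceed the mean slope
    [chi' z2] to the left, against concavity at the midpoint [y]. *)
Lemma concave_pos_chi_uu (chi : R -> R) (y : R) :
  smooth_pos chi -> concave_pos chi -> 0 < y -> chi_uu chi y <= 0.
Proof.
  intros S Conc Hy; apply Rnot_lt_le; intros P.
  destruct (continuous_Derive_n chi 2 y S Hy _ (locally_ball _ (mkposreal _ P))) as [d Hd].
  assert (d0 := cond_pos d).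
  (* [d / 2] stays within the radius where [chi''] keeps its sign, [y / 2] keeps [y - h] in the
     domain of [chi]. *)
  set (h := Rmin (d / 2) (y / 2)).
  assert (h0 : 0 < h) by (apply Rmin_pos; lra).
  assert (h1 : h <= d / 2) by apply Rmin_l.
  assert (h2 : h <= y / 2) by apply Rmin_r.
  assert (Pos : forall z, y - h <= z <= y + h -> 0 < Derive_n chi 2 z).
  { intros z Hz.
    assert (B : Rabs (Derive_n chi 2 z - chi_uu chi y) < chi_uu chi y).
    { apply (Hd z), Rabs_def1; simpl; unfold minus, plus, opp; simpl; lra. }
    apply Rabs_def2 in B; lra. }
  assert (MV : forall n a b, a < b -> y - h <= a -> b <= y + h ->
    exists z, a < z < b /\
      Derive_n chi n b - Derive_n chi n a = Derive_n chi (Datatypes.S n) z * (b - a)).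
  { intros n a b ab Ha Hb.
    destruct (MVT_cor2 (Derive_n chi n) (Derive_n chi (Datatypes.S n)) a b ab)
      as [z [E Hz]].
    - intros x Hx; apply is_derive_Reals, is_derive_Derive_n; [exact S|lra].
    - exists z; split; [exact Hz|exact E]. }
  destruct (MV 0%nat y (y + h)) as [z1 [Hz1 E1]]; try lra.
  destruct (MV 0%nat (y - h) y) as [z2 [Hz2 E2]]; try lra.
  destruct (MV 1%nat z2 z1) as [z3 [Hz3 E3]]; try lra.
  assert (P3 : 0 < Derive_n chi 2 z3) by (apply Pos; lra).
  assert (C := Conc (y + h) (y - h) (1 / 2) ltac:(lra) ltac:(lra) ltac:(lra)).
  replace (1 / 2 * (y + h) + (1 - 1 / 2) * (y - h)) with y in C by field.
  change (Derive_n chi 0) with chi in E1, E2.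
  assert (L1 : 0 < Derive_n chi 2 z3 * (z1 - z2)) by (apply Rmult_lt_0_compat; lra).
  rewrite <- E3 in L1.
  assert (L2 : 0 < (Derive_n chi 1 z1 - Derive_n chi 1 z2) * h)
    by (apply Rmult_lt_0_compat; assumption).
  lra.
Qed.

(** This is [tau] in terms of the pointwise values [a = u] and [b = u_x]. With these as independent
    arguments, [tau_x], the variation [z] and their derivatives in [x] or in a parameter become
    algebraic expressions covered by a common chain rule. *)
Definition flux (chi : R -> R) (a b : R) : R := chi_uu chi a * b * a.

(* Derivative of [flux] at [(a,b)] in the direction [(da,db)]. *)
Definition dflux (chi : R -> R) (a b da db : R) : R :=
  Derive_n chi 3 a * da * b * a + chi_uu chi a * db * a + chi_uu chi a * b * da.

(* Derivative of [dflux] at [(a,b,c,d)] in the direction [(da,db,dc,dd)]. *)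
Definition ddflux (chi : R -> R) (a b c d da db dc dd : R) : R :=
  (Derive_n chi 4 a * da * c * b * a + Derive_n chi 3 a * dc * b * a
   + Derive_n chi 3 a * c * db * a + Derive_n chi 3 a * c * b * da)
  + (Derive_n chi 3 a * da * d * a + chi_uu chi a * dd * a + chi_uu chi a * d * da)
  + (Derive_n chi 3 a * da * b * c + chi_uu chi a * db * c + chi_uu chi a * b * dc).

Ltac derive_in :=
  repeat match goal with
  | |- is_derive_in _ (fun y => _ + _) _ _ =>
      apply is_derive_in_plus; [first [assumption | exact I]| |]
  | |- is_derive_in _ (fun y => _ * _) _ _ =>
      apply is_derive_in_mult; [first [assumption | exact I]| |]
  | |- is_derive_in _ (fun y => Derive_n ?h ?n (@?a y)) _ _ =>
      apply (is_derive_in_comp _ (Derive_n h n) a); [first [assumption | exact I]| |apply is_derive_Derive_n]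
  | |- is_derive_in _ (fun y => / (@?a y)) _ _ =>
      apply (is_derive_in_inv _ a); [first [assumption | exact I]| |]
  end; try eassumption.

Lemma is_derive_in_flux (chi : R -> R) (D : R -> Prop) (a b : R -> R) (x da db : R) :
  smooth_pos chi -> D x -> 0 < a x ->
  is_derive_in D a x da -> is_derive_in D b x db ->
  is_derive_in D (fun y => flux chi (a y) (b y)) x (dflux chi (a x) (b x) da db).
Proof.
  intros S Dx Ha Da Db; unfold flux; eapply is_derive_in_eq.
  - unfold chi_uu; derive_in.
  - unfold dflux, chi_uu; ring.
Qed.

Lemma is_derive_in_dflux (chi : R -> R) (D : R -> Prop) (a b c d : R -> R)
  (x da db dc dd : R) :
  smooth_pos chi -> D x -> 0 < a x ->
  is_derive_in D a x da -> is_derive_in D b x db ->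
  is_derive_in D c x dc -> is_derive_in D d x dd ->
  is_derive_in D (fun y => dflux chi (a y) (b y) (c y) (d y)) x
    (ddflux chi (a x) (b x) (c x) (d x) da db dc dd).
Proof.
  intros S Dx Ha Da Db Dc Dd; unfold dflux; eapply is_derive_in_eq.
  - unfold chi_uu; derive_in.
  - unfold ddflux, chi_uu; ring.
Qed.

(** The left side is the parameter derivative of [tau_x], the right side the [x]-derivative of [z].
    They agree because the second differential of [flux] is symmetric in the directions [(vx, vxx)]
    and [(f, fx)], and the first-order term uses the same [(fx, fxx)] in both. *)
Lemma ddflux_sym (chi : R -> R) (v vx vxx f fx fxx : R) :
  ddflux chi v vx vx vxx f fx fx fxx = ddflux chi v vx f fx vx vxx fx fxx.
Proof. unfold ddflux; ring. Qed.

Ltac continuity_on :=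
  repeat match goal with
  | |- continuous_on _ (fun p => _ + _) => apply continuous_on_plus
  | |- continuous_on _ (fun p => _ * _) => apply continuous_on_mult
  | |- continuous_on _ (fun p => - _) => apply continuous_on_opp
  end; try eassumption.

Section FluxContinuity.
Context {U : UniformSpace} (D : U -> Prop) (chi : R -> R).
Context (chi_smooth : smooth_pos chi).

Lemma continuous_on_Derive_n (n : nat) (a : U -> R) :
  (forall p, D p -> 0 < a p) -> continuous_on D a ->
  continuous_on D (fun p => Derive_n chi n (a p)).
Proof.
  intros Pos Ca; apply (continuous_on_comp_continuous D (Derive_n chi n)); [|exact Ca].
  intros p Dp; apply continuous_Derive_n; auto.
Qed.

Lemma continuous_on_flux (a b : U -> R) :
  (forall p, D p -> 0 < a p) -> continuous_on D a -> continuous_on D b ->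
  continuous_on D (fun p => flux chi (a p) (b p)).
Proof.
  intros Pos Ca Cb; assert (C := fun n => continuous_on_Derive_n n a Pos Ca).
  unfold flux, chi_uu; continuity_on; apply C.
Qed.

Lemma continuous_on_dflux (a b c d : U -> R) :
  (forall p, D p -> 0 < a p) -> continuous_on D a -> continuous_on D b ->
  continuous_on D c -> continuous_on D d ->
  continuous_on D (fun p => dflux chi (a p) (b p) (c p) (d p)).
Proof.
  intros Pos Ca Cb Cc Cd; assert (C := fun n => continuous_on_Derive_n n a Pos Ca).
  unfold dflux, chi_uu; continuity_on; apply C.
Qed.

Lemma continuous_on_ddflux (a b c d da db dc dd : U -> R) :
  (forall p, D p -> 0 < a p) -> continuous_on D a -> continuous_on D b ->
  continuous_on D c -> continuous_on D d -> continuous_on D da -> continuous_on D db ->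
  continuous_on D dc -> continuous_on D dd ->
  continuous_on D
    (fun p => ddflux chi (a p) (b p) (c p) (d p) (da p) (db p) (dc p) (dd p)).
Proof.
  intros Pos Ca; intros; assert (C := fun n => continuous_on_Derive_n n a Pos Ca).
  unfold ddflux, chi_uu; continuity_on; apply C.
Qed.

End FluxContinuity.

(** * The dissipation identity *)

Lemma is_RInt_eq (f g : R -> R) (a b l : R) :
  (forall x, f x = g x) -> is_RInt f a b l -> is_RInt g a b l.
Proof. intros E; apply is_RInt_ext; intros x _; apply E. Qed.

Lemma RInt_eq (f g : R -> R) (a b : R) :
  (forall x, f x = g x) -> RInt f a b = RInt g a b.
Proof. intros E; apply RInt_ext; intros x _; apply E. Qed.

Lemma is_RInt_linear (f g : R -> R) (a b k If Ig : R) :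
  is_RInt f a b If -> is_RInt g a b Ig ->
  is_RInt (fun x => f x + k * g x) a b (If + k * Ig).
Proof.
  intros Hf Hg; apply (is_RInt_plus (V := R_NormedModule)); [exact Hf|].
  exact (is_RInt_scal (V := R_NormedModule) g a b k Ig Hg).
Qed.

Lemma is_RInt_R_derive (f f' : R -> R) (a b : R) :
  (forall x : R, is_derive f x (f' x)) -> (forall x : R, continuous f' x) ->
  is_RInt f' a b (f b - f a).
Proof.
  intros D C; apply (is_RInt_derive (V := R_CompleteNormedModule) f f'); auto.
Qed.

Lemma is_RInt_continuous (f : R -> R) (a b : R) :
  (forall x : R, continuous f x) -> is_RInt f a b (RInt f a b).
Proof.
  intros C; apply (RInt_correct (V := R_CompleteNormedModule)).
  apply (ex_RInt_continuous (V := R_CompleteNormedModule)); auto.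
Qed.

Lemma is_derive_primitive (f : R -> R) (x : R) :
  (forall y, continuous f y) -> is_derive (Defs.primitive f) x (f x).
Proof.
  intros C; apply (is_derive_RInt (V := R_NormedModule) f (Defs.primitive f) 0 x); [|apply C].
  exists (mkposreal 1 Rlt_0_1); intros y _; apply is_RInt_continuous, C.
Qed.

Lemma is_derive_continuous (f : R -> R) (x l : R) : is_derive f x l -> continuous f x.
Proof. intros H; apply (ex_derive_continuous f x); exists l; exact H. Qed.

(* The integrand differs from [2 chi'' (f - q v_x / v)^2] by the [x]-derivative of
   [- 2 q chi'' f + q^2 chi'' v_x / v]. *)
Lemma is_RInt_dissipation (chi v vx vxx f fx q : R -> R) :
  smooth_pos chi -> (forall x : R, 0 < v x) ->
  (forall x : R, is_derive v x (vx x)) -> (forall x : R, is_derive vx x (vxx x)) ->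
  (forall x : R, is_derive f x (fx x)) -> (forall x : R, is_derive q x (f x)) ->
  (forall x : R, continuous vxx x) -> (forall x : R, continuous fx x) ->
  v 1 = v 0 -> vx 1 = vx 0 -> f 1 = f 0 -> q 1 = q 0 ->
  is_RInt (fun x => - 2 * (q x * dflux chi (v x) (vx x) (f x) (fx x) * / v x)
                    + q x * q x * dflux chi (v x) (vx x) (vx x) (vxx x) * / v x * / v x)
    0 1 (2 * RInt (fun x => chi_uu chi (v x) * (f x - q x * vx x / v x) ^ 2) 0 1).
Proof.
  intros S Pos Dv Dvx Df Dq Cvxx Cfx Pv Pvx Pf Pq.
  set (h := fun x => -2 * q x * Derive_n chi 2 (v x) * f x
                     + q x * q x * Derive_n chi 2 (v x) * vx x * / v x).
  set (dh := fun x =>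
    -2 * f x * Derive_n chi 2 (v x) * f x
    + -2 * q x * (vx x * Derive_n chi 3 (v x)) * f x
    + -2 * q x * Derive_n chi 2 (v x) * fx x
    + 2 * q x * f x * Derive_n chi 2 (v x) * vx x * / v x
    + q x * q x * (vx x * Derive_n chi 3 (v x)) * vx x * / v x
    + q x * q x * Derive_n chi 2 (v x) * vxx x * / v x
    + - (q x * q x * Derive_n chi 2 (v x) * vx x * vx x * / v x * / v x)).
  (* The squared [K] is spelled out with sums, products and inverses only, the shape on which
     [continuity_on] operates. *)
  set (k := fun x => Derive_n chi 2 (v x) * (f x + - (q x * vx x * / v x))
                     * (f x + - (q x * vx x * / v x))).
  assert (N : forall x, v x <> 0) by (intros x; apply Rgt_not_eq, Pos).
  assert (C : forall g l : R -> R, (forall x : R, is_derive g x (l x)) -> continuous_on (fun _ => True) g).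
  { intros g l H; apply continuous_on_continuous; intros x _.
    exact (is_derive_continuous g x (l x) (H x)). }
  assert (Cv := C _ _ Dv); assert (Cvx := C _ _ Dvx); assert (Cf := C _ _ Df).
  assert (Cq := C _ _ Dq).
  assert (Cvxx' : continuous_on (fun _ => True) vxx)
    by (apply continuous_on_continuous; auto).
  assert (Cfx' : continuous_on (fun _ => True) fx)
    by (apply continuous_on_continuous; auto).
  assert (Cinv : continuous_on (fun _ => True) (fun x => / v x))
    by (apply continuous_on_inv; auto).
  assert (Cchi := fun n =>
    continuous_on_Derive_n (fun _ => True) chi S n v (fun x _ => Pos x) Cv).
  assert (Cc := continuous_on_const (fun _ : R => True)).
  assert (Ck : forall x, continuous k x).
  { intros x; apply continuous_on_True; unfold k; continuity_on; apply Cchi. }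
  assert (Idh : is_RInt dh 0 1 (h 1 - h 0)).
  { apply is_RInt_R_derive.
    - intros x; apply is_derive_in_True; unfold h.
      assert (Dv' := proj2 (is_derive_in_True v x _) (Dv x)).
      assert (Dvx' := proj2 (is_derive_in_True vx x _) (Dvx x)).
      assert (Df' := proj2 (is_derive_in_True f x _) (Df x)).
      assert (Dq' := proj2 (is_derive_in_True q x _) (Dq x)).
      assert (Dc := is_derive_in_const (fun _ => True) (-2) x I).
      eapply is_derive_in_eq; [derive_in; auto|].
      unfold dh; field; apply N.
    - intros x; apply continuous_on_True; unfold dh; continuity_on;
        first [apply Cchi|apply Cc]. }
  replace (h 1 - h 0) with 0 in Idh by (unfold h; rewrite Pv, Pvx, Pf, Pq; ring).
  assert (Ik := is_RInt_linear dh k 0 1 2 _ _ Idh (is_RInt_continuous k 0 1 Ck)).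
  rewrite Rplus_0_l in Ik.
  replace (RInt (fun x => chi_uu chi (v x) * (f x - q x * vx x / v x) ^ 2) 0 1)
    with (RInt k 0 1)
    by (apply RInt_eq; intros x; unfold k, chi_uu; simpl; field; apply N).
  revert Ik; apply is_RInt_eq; intros x.
  unfold dh, k, dflux, chi_uu; field; apply N.
Qed.

(** [Q] subtracts from the primitive [F] its mean [c = J / I] for the weight [1 / v], so the squared
    norm is an unnormalised variance: [N - 2 c J + c^2 I] collapses to [N - J^2 / I]. In this form
    no parameter-dependent constant remains under an integral sign. *)
Lemma normG2_expand (v f : R -> R) :
  (forall x : R, 0 < v x) -> (forall x : R, continuous v x) ->
  (forall x : R, continuous f x) ->
  let F := Defs.primitive f in
  let N := RInt (fun x => F x * F x * / v x) 0 1 in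
  let J := RInt (fun x => F x * / v x) 0 1 in
  let I := RInt (fun x => / v x) 0 1 in
  0 < I /\ (forall x, Q v f x = F x + - (J * / I)) /\ normG2 v f = N + - (J * J * / I).
Proof.
  intros Pos Cv Cf F N J I.
  assert (N0 : forall x, v x <> 0) by (intros x; apply Rgt_not_eq, Pos).
  assert (Cinv : forall x, continuous (fun x => / v x) x)
    by (intros x; apply continuous_Rinv_comp; auto).
  assert (CF : forall x, continuous F x).
  { intros x; apply (is_derive_continuous F x (f x)), is_derive_primitive, Cf. }
  assert (I0 : 0 < I).
  { apply RInt_gt_0; [lra| |auto]; intros x _; apply Rinv_0_lt_compat, Pos. }
  assert (CJ : forall x, continuous (fun x => F x * / v x) x)
    by (intros x; apply (continuous_mult F (fun x => / v x)); auto).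
  assert (CN : forall x, continuous (fun x => F x * F x * / v x) x).
  { intros x; apply (continuous_mult (fun x => F x * F x) (fun x => / v x)); auto.
    apply (continuous_mult F F); auto. }
  assert (HQ : forall x, Q v f x = F x + - (J * / I)).
  { intros x; unfold Q, J; fold F I.
    rewrite (RInt_eq (fun y => / v y * F y) (fun x => F x * / v x))
      by (intros; apply Rmult_comm).
    reflexivity. }
  split; [exact I0|split; [exact HQ|]].
  unfold normG2, G; apply is_RInt_unique.
  set (c := J * / I) in *.
  replace (N + - (J * J * / I)) with (N + -2 * c * J + c * c * I)
    by (unfold c; field; lra).
  assert (L := is_RInt_linear _ _ _ _ (c * c) _ _
    (is_RInt_linear _ _ _ _ (-2 * c) _ _
       (is_RInt_continuous _ 0 1 CN) (is_RInt_continuous _ 0 1 CJ))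
    (is_RInt_continuous _ 0 1 Cinv)).
  revert L; apply is_RInt_eq; intros x; rewrite HQ; ring.
Qed.

(** Only the flow and the linearised flow [f_t = - z_x] are assumed, with no second parameter in
    sight, so that both [u_s] and [u_t] are instances of [f]. *)
Lemma is_derive_in_normG2 (chi : R -> R) (T : R -> Prop) (v vx vxx f fx fxx : R -> R -> R) :
  smooth_pos chi -> interval T ->
  (forall t x, T t -> 0 < v t x) ->
  (forall t x, T t -> is_derive (v t) x (vx t x)) ->
  (forall t x, T t -> is_derive (vx t) x (vxx t x)) ->
  (forall t x, T t -> is_derive (f t) x (fx t x)) ->
  (forall t x, T t -> is_derive (fx t) x (fxx t x)) ->
  continuous_on (strip T) (uncurry2 v) -> continuous_on (strip T) (uncurry2 vx) ->
  continuous_on (strip T) (uncurry2 vxx) -> continuous_on (strip T) (uncurry2 f) ->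
  continuous_on (strip T) (uncurry2 fx) -> continuous_on (strip T) (uncurry2 fxx) ->
  (forall t, T t -> v t 1 = v t 0) -> (forall t, T t -> vx t 1 = vx t 0) ->
  (forall t, T t -> f t 1 = f t 0) -> (forall t, T t -> RInt (f t) 0 1 = 0) ->
  (forall t x, T t -> is_derive_in T (fun t' => v t' x) t
     (- dflux chi (v t x) (vx t x) (vx t x) (vxx t x))) ->
  (forall t x, T t -> is_derive_in T (fun t' => f t' x) t
     (- ddflux chi (v t x) (vx t x) (f t x) (fx t x) (vx t x) (vxx t x) (fx t x) (fxx t x))) ->
  forall t, T t ->
    is_derive_in T (fun t' => normG2 (v t') (f t')) t
      (2 * RInt (fun x => chi_uu chi (v t x) * (K (v t) (f t) x) ^ 2) 0 1).
Proof.
  intros S IT Pos Dv Dvx Df Dfx Cv Cvx Cvxx Cf Cfx Cfxx Pv Pvx Pf Zf Tv Tf t Tt.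
  assert (Nv : forall t x, T t -> v t x <> 0) by (intros; apply Rgt_not_eq, Pos; assumption).
  set (F := fun t x => Defs.primitive (f t) x).
  (* In the notation of the overview, [w1] is [tau_x], [z] is the variation of [tau] in the
     direction [f], and [z1] is [z_x]. *)
  set (w1 := fun t x => dflux chi (v t x) (vx t x) (vx t x) (vxx t x)).
  set (z := fun t x => dflux chi (v t x) (vx t x) (f t x) (fx t x)).
  set (z1 := fun t x => ddflux chi (v t x) (vx t x) (f t x) (fx t x)
                          (vx t x) (vxx t x) (fx t x) (fxx t x)).
  assert (Sec : forall (g : R -> R -> R) t x, continuous_on (strip T) (uncurry2 g) -> T t ->
                continuous (g t) x)
    by (intros g s x Cg Ts; exact (continuous_strip_section T g s x Cg Ts)).
  assert (Pos' : forall p, strip T p -> 0 < uncurry2 v p) by (intros p; apply Pos).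
  assert (Cw1 : continuous_on (strip T) (uncurry2 w1))
    by exact (continuous_on_dflux (strip T) chi S _ _ _ _ Pos' Cv Cvx Cvx Cvxx).
  assert (Cz : continuous_on (strip T) (uncurry2 z))
    by exact (continuous_on_dflux (strip T) chi S _ _ _ _ Pos' Cv Cvx Cf Cfx).
  assert (Cz1 : continuous_on (strip T) (uncurry2 z1))
    by exact (continuous_on_ddflux (strip T) chi S _ _ _ _ _ _ _ _
                Pos' Cv Cvx Cf Cfx Cvx Cvxx Cfx Cfxx).
  assert (Cinv : continuous_on (strip T) (uncurry2 (fun t x => / v t x)))
    by (apply (continuous_on_inv (strip T) (uncurry2 v)); [intros p; apply Nv|exact Cv]).
  assert (Dz : forall t x, T t -> is_derive (z t) x (z1 t x)).
  { intros s x Ts; apply (proj1 (is_derive_in_True (z s) x _)).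
    assert (D := fun g l => proj2 (is_derive_in_True g x l)).
    exact (is_derive_in_dflux chi (fun _ => True) (v s) (vx s) (f s) (fx s) x _ _ _ _ S Logic.I
      (Pos s x Ts) (D _ _ (Dv s x Ts)) (D _ _ (Dvx s x Ts)) (D _ _ (Df s x Ts))
      (D _ _ (Dfx s x Ts))). }
  assert (DF : forall t x, T t -> is_derive (F t) x (f t x)).
  { intros t' x Tt'; apply is_derive_primitive; intros y; auto. }
  (* Integrating [f_t = - z_x] from 0 to [x] leaves the boundary value [z t 0]: this is the constant
     in [x] that the zero mean of [q / v] removes below. *)
  assert (TF : forall t x, T t -> is_derive_in T (fun t' => F t' x) t (z t 0 - z t x)).
  { intros t' x Tt'; unfold F, Defs.primitive.
    apply is_derive_in_eq with (RInt (fun y => - z1 t' y) 0 x).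
    - apply (is_derive_in_RInt_param T f (fun t y => - z1 t y)); auto.
      exact (continuous_on_opp (strip T) (uncurry2 z1) Cz1).
    - apply is_RInt_unique.
      apply is_RInt_eq with (fun y => 0 + -1 * z1 t' y); [intros; ring|].
      replace (z t' 0 - z t' x) with (scal (x - 0) 0 + -1 * (z t' x - z t' 0))
        by (unfold scal; simpl; unfold mult; simpl; ring).
      apply is_RInt_linear; [apply (is_RInt_const (V := R_NormedModule))|].
      apply is_RInt_R_derive; intros y; auto. }
  (* [F] is built by integration for each [t] separately; joint continuity comes from the jointly
     continuous [F_x = f] and from differentiability in [t]. *)
  assert (CF : continuous_on (strip T) (uncurry2 F)).
  { apply (continuous_on_strip_of_partial T F f); auto.
    intros x s Ts; exact (is_derive_in_continuous T _ s _ Ts (TF s x Ts)). }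
  assert (CFt : continuous_on (strip T) (uncurry2 (fun t x => z t 0 - z t x))).
  { apply (continuous_on_plus (strip T) (fun p => z (fst p) 0) (fun p => - uncurry2 z p)).
    - apply (continuous_on_comp (strip T) (strip T) (uncurry2 z)
               (fun p : R * R => (fst p, 0))); [auto| |exact Cz].
      apply continuous_on_pair; apply continuous_on_continuous; intros p _;
        [apply continuous_fst|apply continuous_const].
    - exact (continuous_on_opp (strip T) (uncurry2 z) Cz). }
  assert (Tinv : forall t x, T t ->
    is_derive_in T (fun t' => / v t' x) t (w1 t x * / v t x * / v t x)).
  { intros s x Ts; apply is_derive_in_eq with (- - w1 s x / v s x ^ 2).
    - exact (is_derive_in_inv T (fun t => v t x) s _ Ts (Nv s x Ts) (Tv s x Ts)).
    - field; auto. }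
  (* [it], [jt] and [nt] are the [t]-derivatives of [1 / v], [F / v] and [F^2 / v], computed with
     [v_t = - tau_x]. *)
  set (it := fun t x => w1 t x * / v t x * / v t x).
  set (jt := fun t x => (z t 0 - z t x) * / v t x + F t x * it t x).
  set (nt := fun t x => 2 * (F t x * (z t 0 - z t x) * / v t x) + F t x * F t x * it t x).
  assert (Cit : continuous_on (strip T) (uncurry2 it)).
  { apply (continuous_on_mult (strip T)
             (fun p => uncurry2 w1 p * uncurry2 (fun t x => / v t x) p)); [|exact Cinv].
    apply continuous_on_mult; assumption. }
  assert (Cjt : continuous_on (strip T) (uncurry2 jt)).
  { apply (continuous_on_plus (strip T)
             (fun p => uncurry2 (fun t x => z t 0 - z t x) p
                       * uncurry2 (fun t x => / v t x) p)
             (fun p => uncurry2 F p * uncurry2 it p));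
      apply continuous_on_mult; assumption. }
  assert (Cnt : continuous_on (strip T) (uncurry2 nt)).
  { apply (continuous_on_plus (strip T)
             (fun p => 2 * (uncurry2 F p * uncurry2 (fun t x => z t 0 - z t x) p
                            * uncurry2 (fun t x => / v t x) p))
             (fun p => uncurry2 F p * uncurry2 F p * uncurry2 it p));
      continuity_on; apply continuous_on_const. }
  assert (Cxinv : forall t x, T t -> continuous (fun x => / v t x) x)
    by (intros s x; exact (Sec (fun t x => / v t x) s x Cinv)).
  assert (CxF : forall t x, T t -> continuous (F t) x)
    by (intros s x; exact (Sec F s x CF)).
  assert (TI : is_derive_in T (fun t => RInt (fun x => / v t x) 0 1) t (RInt (it t) 0 1)).
  { apply (is_derive_in_RInt_param T (fun t x => / v t x) it); auto. }
  assert (TJ : is_derive_in T (fun t => RInt (fun x => F t x * / v t x) 0 1) t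
                 (RInt (jt t) 0 1)).
  { apply (is_derive_in_RInt_param T (fun t x => F t x * / v t x) jt); auto.
    - intros s x Ts; assert (A := TF s x Ts); assert (B := Tinv s x Ts).
      exact (is_derive_in_mult T (fun t => F t x) (fun t => / v t x) s _ _ Ts A B).
    - intros s x Ts; apply (continuous_mult (F s) (fun x => / v s x)); auto. }
  assert (TN : is_derive_in T (fun t => RInt (fun x => F t x * F t x * / v t x) 0 1) t
                 (RInt (nt t) 0 1)).
  { apply (is_derive_in_RInt_param T (fun t x => F t x * F t x * / v t x) nt); auto.
    - intros s x Ts; assert (A := TF s x Ts); assert (B := Tinv s x Ts).
      eapply is_derive_in_eq.
      + apply (is_derive_in_mult T (fun t => F t x * F t x) (fun t => / v t x)); eauto.
        apply (is_derive_in_mult T (fun t => F t x) (fun t => F t x)); eauto.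
      + unfold nt, it; ring.
    - intros s x Ts; apply (continuous_mult (fun x => F s x * F s x) (fun x => / v s x)); auto.
      apply (continuous_mult (F s) (F s)); auto. }
  destruct (normG2_expand (v t) (f t)) as [I0 [HQ _]]; auto.
  fold (F t) in HQ.
  set (I := fun t => RInt (fun x => / v t x) 0 1) in *.
  set (J := fun t => RInt (fun x => F t x * / v t x) 0 1) in *.
  set (N := fun t => RInt (fun x => F t x * F t x * / v t x) 0 1) in *.
  apply is_derive_in_ext with (fun t => N t + -1 * (J t * J t * / I t)); [exact Tt| |].
  { intros s Ts; destruct (normG2_expand (v s) (f s)) as [_ [_ E]]; auto.
    rewrite E; unfold N, J, I, F; ring. }
  change (0 < I t) in I0.
  assert (HQ' : forall x, Q (v t) (f t) x = F t x + - (J t * / I t)) by exact HQ.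
  set (c := J t * / I t) in *.
  (* Differentiating [N - J^2 / I] gives [N' - 2 c J' + c^2 I'], as if [c] were constant in [t]:
     [c = J / I] is the critical point of [N - 2 c J + c^2 I]. *)
  apply is_derive_in_eq with
    (RInt (nt t) 0 1 + -2 * c * RInt (jt t) 0 1 + c * c * RInt (it t) 0 1).
  { eapply is_derive_in_eq.
    - apply is_derive_in_plus; [exact Tt|exact TN|].
      apply is_derive_in_mult; [exact Tt|apply is_derive_in_const, Tt|].
      apply is_derive_in_mult; [exact Tt|apply is_derive_in_mult; eauto|].
      apply is_derive_in_inv; [exact Tt|lra|exact TI].
    - unfold c; field; lra. }
  set (q := fun x => F t x + - c).
  assert (L := is_RInt_linear _ _ 0 1 (c * c) _ _
    (is_RInt_linear _ _ 0 1 (-2 * c) _ _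
       (is_RInt_continuous (nt t) 0 1 (fun x => Sec nt t x Cnt Tt))
       (is_RInt_continuous (jt t) 0 1 (fun x => Sec jt t x Cjt Tt)))
    (is_RInt_continuous (it t) 0 1 (fun x => Sec it t x Cit Tt))).
  (* The zero mean of [q / v]. Multiplied by [2 * z t 0] and added to the dissipation identity in
     [M], it accounts for the boundary value in [F_t]. *)
  assert (P := is_RInt_linear _ _ 0 1 (- c) _ _
    (is_RInt_continuous (fun x => F t x * / v t x) 0 1
       (fun x => continuous_mult (F t) (fun x => / v t x) x (CxF t x Tt) (Cxinv t x Tt)))
    (is_RInt_continuous (fun x => / v t x) 0 1 (fun x => Cxinv t x Tt))).
  change (RInt (fun x => F t x * / v t x) 0 1) with (J t) in P.
  change (RInt (fun x => / v t x) 0 1) with (I t) in P.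
  replace (J t + - c * I t) with 0 in P by (unfold c; field; lra).
  assert (Dis := is_RInt_dissipation chi (v t) (vx t) (vxx t) (f t) (fx t) q S
    (fun x => Pos t x Tt) (fun x => Dv t x Tt) (fun x => Dvx t x Tt) (fun x => Df t x Tt)).
  assert (M := is_RInt_linear _ _ 0 1 (2 * z t 0) _ _ (Dis
    ltac:(intros x; rewrite <- (Rplus_0_r (f t x)); unfold q;
          apply (is_derive_plus (F t) (fun _ => - c) x (f t x) 0);
          [auto|exact (is_derive_const (- c) x)])
    (fun x => Sec vxx t x Cvxx Tt) (fun x => Sec fx t x Cfx Tt)
    (Pv t Tt) (Pvx t Tt) (Pf t Tt)
    ltac:(unfold q, F, Defs.primitive; rewrite (Zf t Tt), RInt_point; reflexivity)) P).
  rewrite <- (is_RInt_unique _ _ _ _ L).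
  replace (2 * RInt (fun x => chi_uu chi (v t x) * (K (v t) (f t) x) ^ 2) 0 1) with
    (2 * RInt (fun x => chi_uu chi (v t x) * (f t x - q x * vx t x / v t x) ^ 2) 0 1
     + 2 * z t 0 * 0).
  (* Both integrands equal [2 q (z t 0 - z) / v + q^2 tau_x / v^2], where [q = F - c]. *)
  - rewrite <- (is_RInt_unique _ _ _ _ M); apply RInt_eq; intros x.
    unfold nt, jt, it, q, w1, z; ring.
  - rewrite Rmult_0_r, Rplus_0_r; f_equal; apply RInt_eq; intros x.
    unfold K; rewrite HQ', (is_derive_unique _ _ _ (Dv t x Tt)); reflexivity.
Qed.

(** * The flow *)

Lemma is_derive_tau (chi v vx vxx : R -> R) (x : R) :
  smooth_pos chi -> (forall y : R, 0 < v y) ->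
  (forall y : R, is_derive v y (vx y)) -> (forall y : R, is_derive vx y (vxx y)) ->
  is_derive (tau chi v) x (dflux chi (v x) (vx x) (vx x) (vxx x)).
Proof.
  intros S Pos Dv Dvx.
  apply (is_derive_ext (fun y => flux chi (v y) (vx y))).
  - intros y; unfold tau, flux; rewrite (is_derive_unique v y _ (Dv y)); reflexivity.
  - apply (proj1 (is_derive_in_True _ _ _)).
    apply (is_derive_in_flux chi (fun _ => True) v vx); auto;
      apply (proj2 (is_derive_in_True _ _ _)); auto.
Qed.

Lemma is_derive_periodic (f f' : R -> R) (x : R) :
  (forall y : R, f (y + 1) = f y) -> (forall y : R, is_derive f y (f' y)) ->
  f' (x + 1) = f' x.
Proof.
  intros P D; rewrite <- (is_derive_unique f x (f' x) (D x)).
  symmetry; apply is_derive_unique.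
  apply (is_derive_ext (fun y => f (y + 1))); [exact P|].
  replace (f' (x + 1)) with (1 * f' (x + 1)) by ring.
  apply (is_derive_comp f (fun y => y + 1) x); [apply D|].
  auto_derive; [exact I|ring].
Qed.

(** The sign is pointwise, [chi'' <= 0] against a square. The rest establishes continuity of the
    integrand, so that the total function [RInt] is an actual integral and respects the sign. *)
Lemma dissipation_nonpos (chi v vx f : R -> R) :
  smooth_pos chi -> concave_pos chi -> (forall x : R, 0 < v x) ->
  (forall x : R, is_derive v x (vx x)) ->
  (forall x : R, continuous vx x) -> (forall x : R, continuous f x) ->
  2 * RInt (fun x => chi_uu chi (v x) * (K v f x) ^ 2) 0 1 <= 0.
Proof.
  intros S Conc Pos Dv Cvx Cf.
  assert (Cv : forall x, continuous v x)
    by (intros x; exact (is_derive_continuous v x _ (Dv x))).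
  destruct (normG2_expand v f Pos Cv Cf) as [_ [HQ _]].
  set (c := _ * / _) in HQ.
  set (F := Defs.primitive f) in *.
  set (k := fun x => f x + - ((F x + - c) * vx x * / v x)).
  assert (EK : forall x, K v f x = k x).
  { intros x; unfold K, k, Rdiv; rewrite HQ, (is_derive_unique v x _ (Dv x)); reflexivity. }
  set (g := fun x => -1 * (Derive_n chi 2 (v x) * (k x * k x))).
  assert (Cg : forall x, continuous g x).
  { assert (C : forall h : R -> R, (forall x : R, continuous h x) ->
                continuous_on (fun _ => True) h)
      by (intros h Ch; apply continuous_on_continuous; auto).
    assert (Cinv := continuous_on_inv (fun _ => True) v
      (fun x _ => Rgt_not_eq _ _ (Pos x)) (C v Cv)).
    assert (CF : continuous_on (fun _ => True) F).
    { apply C; intros x; exact (is_derive_continuous F x _ (is_derive_primitive f x Cf)). }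
    assert (Cchi := continuous_on_Derive_n (fun _ => True) chi S 2 v (fun x _ => Pos x) (C v Cv)).
    assert (Cf' := C f Cf); assert (Cvx' := C vx Cvx).
    intros x; apply continuous_on_True; unfold g, k; continuity_on;
      apply continuous_on_const. }
  assert (G0 : 0 <= RInt g 0 1).
  { apply RInt_ge_0; [lra| |].
    - exists (RInt g 0 1); exact (is_RInt_continuous g 0 1 Cg).
    - intros x _; unfold g.
      assert (A := concave_pos_chi_uu chi (v x) S Conc (Pos x)); unfold chi_uu in A.
      assert (B := Rle_0_sqr (k x)); unfold Rsqr in B; nra. }
  assert (L := is_RInt_linear (fun _ => 0) g 0 1 (-1) _ _
    (is_RInt_const (V := R_NormedModule) 0 1 0) (is_RInt_continuous g 0 1 Cg)).
  assert (E : RInt (fun x => chi_uu chi (v x) * (K v f x) ^ 2) 0 1 = - RInt g 0 1).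
  { apply is_RInt_unique.
    replace (- RInt g 0 1) with (scal (1 - 0) 0 + -1 * RInt g 0 1)
      by (unfold scal; simpl; unfold mult; simpl; ring).
    revert L; apply is_RInt_eq; intros x; rewrite EK; unfold g, chi_uu; ring. }
  rewrite E; lra.
Qed.

(** The parameter [p] stands for [s] or for [t]. Smoothness supplies the [x]-derivatives of [up];
    two applications of [mixed_partials] turn them into the [p]-derivatives of [ux] and [uxx]. The
    chain rule then differentiates [tau_x], and [ddflux_sym] brings the result to the form [z_x]. *)
Lemma family_derivatives (chi : R -> R) (P : R -> Prop)
  (u up ux uxx upx upxx : R -> R -> R) :
  smooth_pos chi -> interval P ->
  (forall p x, P p -> 0 < u p x) ->
  (forall p x, P p -> is_derive_in P (fun p' => u p' x) p (up p x)) ->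
  (forall p x, P p -> is_derive (u p) x (ux p x)) ->
  (forall p x, P p -> is_derive (ux p) x (uxx p x)) ->
  (forall p x, P p -> is_derive (up p) x (upx p x)) ->
  (forall p x, P p -> is_derive (upx p) x (upxx p x)) ->
  continuous_on (strip P) (uncurry2 up) -> continuous_on (strip P) (uncurry2 upx) ->
  continuous_on (strip P) (uncurry2 upxx) ->
  forall p x, P p ->
    is_derive_in P (fun p' => dflux chi (u p' x) (ux p' x) (ux p' x) (uxx p' x)) p
      (ddflux chi (u p x) (ux p x) (up p x) (upx p x)
         (ux p x) (uxx p x) (upx p x) (upxx p x)).
Proof.
  intros S IP Pos Dp Dx Dxx Dpx Dpxx Cp Cpx Cpxx p x Pp.
  assert (Tr := fun g y l => proj2 (is_derive_in_True g y l)).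
  assert (Sub : forall g, continuous_on (strip P) (uncurry2 g) ->
    continuous_on (fun z : R * R => P (fst z) /\ True) (uncurry2 g)).
  { intros g; apply continuous_on_subset; intros z [Hz _]; exact Hz. }
  assert (M1 : forall p x, P p -> is_derive_in P (fun p' => ux p' x) p (upx p x)).
  { intros s y Ps.
    apply (mixed_partials P (fun _ => True) u up ux upx IP interval_True); auto.
    - intros q _; exact (continuous_on_strip_slice P up q Cp). }
  assert (M2 : forall p x, P p -> is_derive_in P (fun p' => uxx p' x) p (upxx p x)).
  { intros s y Ps.
    apply (mixed_partials P (fun _ => True) ux upx uxx upxx IP interval_True); auto.
    - intros q _; exact (continuous_on_strip_slice P upx q Cpx). }
  rewrite <- ddflux_sym.
  apply (is_derive_in_dflux chi P (fun p => u p x) (fun p => ux p x) (fun p => ux p x)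
           (fun p => uxx p x)); auto.
Qed.

(** Differentiating the constant mass under the integral sign. For the primitive, zero mean of the
    velocity means equal values at 0 and 1, one of the periodicity conditions behind the dissipation
    identity. *)
Lemma family_zero_mean (P : R -> Prop) (u up : R -> R -> R) (m p : R) :
  interval P -> P p ->
  (forall p x, P p -> is_derive_in P (fun p' => u p' x) p (up p x)) ->
  (forall p x, P p -> continuous (u p) x) ->
  continuous_on (strip P) (uncurry2 up) ->
  (forall p, P p -> RInt (u p) 0 1 = m) -> RInt (up p) 0 1 = 0.
Proof.
  intros IP Pp Dp Cu Cp Hm.
  apply (is_derive_in_unique P (fun p => RInt (u p) 0 1) p); auto.
  - apply is_derive_in_RInt_param; auto.
  - apply is_derive_in_ext with (fun _ => m); [exact Pp| |apply is_derive_in_const, Pp].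
    intros q Pq; symmetry; auto.
Qed.

Lemma family_periodic (P : R -> Prop) (u up : R -> R -> R) (p x : R) :
  interval P -> P p ->
  (forall p x, P p -> is_derive_in P (fun p' => u p' x) p (up p x)) ->
  (forall p x, P p -> u p (x + 1) = u p x) -> up p (x + 1) = up p x.
Proof.
  intros IP Pp Dp Per.
  apply (is_derive_in_unique P (fun p => u p x) p); auto.
  apply is_derive_in_ext with (fun p => u p (x + 1)); auto.
Qed.

(** * First variation of the volume, and the energy as a squared norm *)

Section FlowIdentities.
Context (chi v vx vxx : R -> R).
Context (chi_smooth : smooth_pos chi) (v_pos : forall x : R, 0 < v x).
Context (Dv : forall x : R, is_derive v x (vx x)).
Context (Dvx : forall x : R, is_derive vx x (vxx x)).
Context (Cvxx : forall x : R, continuous vxx x).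
Context (v_periodic : v 1 = v 0) (vx_periodic : vx 1 = vx 0).

Let w1 (x : R) : R := dflux chi (v x) (vx x) (vx x) (vxx x).

Lemma tau_flux (x : R) : tau chi v x = flux chi (v x) (vx x).
Proof. unfold tau, flux; rewrite (is_derive_unique v x _ (Dv x)); reflexivity. Qed.

Lemma continuous_flow_terms :
  (forall x, continuous w1 x) /\ (forall x, continuous (fun x => flux chi (v x) (vx x)) x) /\
  (forall n x, continuous (fun x => Derive_n chi n (v x)) x).
Proof.
  assert (C : forall g l : R -> R, (forall x : R, is_derive g x (l x)) ->
              continuous_on (fun _ => True) g).
  { intros g l H; apply continuous_on_continuous; intros x _.
    exact (is_derive_continuous g x (l x) (H x)). }
  assert (Cv := C _ _ Dv); assert (Cvx := C _ _ Dvx).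
  assert (Cvxx' : continuous_on (fun _ => True) vxx)
    by (apply continuous_on_continuous; auto).
  assert (Pos : forall x : R, True -> 0 < v x) by auto.
  split; [|split].
  - intros x; apply continuous_on_True.
    exact (continuous_on_dflux (fun _ => True) chi chi_smooth v vx vx vxx Pos Cv Cvx Cvx Cvxx').
  - intros x; apply continuous_on_True.
    exact (continuous_on_flux (fun _ => True) chi chi_smooth v vx Pos Cv Cvx).
  - intros n x; apply continuous_on_True.
    exact (continuous_on_Derive_n (fun _ => True) chi chi_smooth n v Pos Cv).
Qed.

(** Integration by parts: the integral of [- tau_x chi'(v)] is that of [tau chi''(v) v_x], the
    boundary terms cancelling by periodicity, and [chi''(v) v_x = tau / v]. *)
Lemma RInt_flow_Vol :
  is_RInt (fun x => - w1 x * Derive_n chi 1 (v x)) 0 1 (E chi v).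
Proof.
  destruct continuous_flow_terms as [Cw1 [Cw Cchi]].
  set (w := fun x => flux chi (v x) (vx x)).
  assert (Cvx : forall x, continuous vx x)
    by (intros x; exact (is_derive_continuous vx x _ (Dvx x))).
  assert (Cvxw : forall x, continuous (fun x => vx x * Derive_n chi 2 (v x) * w x) x).
  { intros x; apply (continuous_mult (fun x => vx x * Derive_n chi 2 (v x)) w); [|apply Cw].
    apply (continuous_mult vx (fun x => Derive_n chi 2 (v x))); auto. }
  assert (Cd : forall x, continuous
    (fun x => vx x * Derive_n chi 2 (v x) * w x + Derive_n chi 1 (v x) * w1 x) x).
  { intros x; apply (continuous_plus (fun x => vx x * Derive_n chi 2 (v x) * w x)
                       (fun x => Derive_n chi 1 (v x) * w1 x)); [apply Cvxw|].
    apply (continuous_mult (fun x => Derive_n chi 1 (v x)) w1); auto. }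
  assert (EE : E chi v = RInt (fun x => vx x * Derive_n chi 2 (v x) * w x) 0 1).
  { apply RInt_eq; intros x; rewrite tau_flux; unfold w, flux, chi_uu; field.
    apply Rgt_not_eq, v_pos. }
  assert (B := is_RInt_R_derive (fun x => Derive_n chi 1 (v x) * w x) _ 0 1
    (fun x => proj1 (is_derive_in_True _ x _)
       (is_derive_in_mult (fun _ => True) (fun x => Derive_n chi 1 (v x)) w x _ _ I
          (is_derive_in_comp (fun _ => True) (Derive_n chi 1) v x _ _ I
             (proj2 (is_derive_in_True v x _) (Dv x))
             (is_derive_Derive_n chi 1 (v x) chi_smooth (v_pos x)))
          (is_derive_in_flux chi (fun _ => True) v vx x _ _ chi_smooth I (v_pos x)
             (proj2 (is_derive_in_True v x _) (Dv x))
             (proj2 (is_derive_in_True vx x _) (Dvx x))))) Cd).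
  replace (_ - _) with 0 in B by (unfold w; rewrite v_periodic, vx_periodic; ring).
  assert (L := is_RInt_linear _ _ 0 1 (-1) _ _ (is_RInt_continuous _ 0 1 Cvxw) B).
  rewrite Rmult_0_r, Rplus_0_r in L; rewrite EE.
  revert L; apply is_RInt_eq; intros x; unfold w1; ring.
Qed.

(* Since [tau / v = (chi' o v)_x] has zero mean, [Q] of the flow velocity is [- tau]. *)
Lemma normG2_flow : normG2 v (fun x => - w1 x) = E chi v.
Proof.
  destruct continuous_flow_terms as [Cw1 [Cw Cchi]].
  set (w := fun x => flux chi (v x) (vx x)).
  assert (Cvx : forall x, continuous vx x)
    by (intros x; exact (is_derive_continuous vx x _ (Dvx x))).
  assert (Cv : forall x, continuous v x)
    by (intros x; exact (is_derive_continuous v x _ (Dv x))).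
  assert (Dw : forall x, is_derive w x (w1 x)).
  { intros x; apply (proj1 (is_derive_in_True _ _ _)).
    exact (is_derive_in_flux chi (fun _ => True) v vx x _ _ chi_smooth I (v_pos x)
             (proj2 (is_derive_in_True v x _) (Dv x))
             (proj2 (is_derive_in_True vx x _) (Dvx x))). }
  assert (Cf : forall x, continuous (fun x => - w1 x) x).
  { intros x; apply (continuous_opp w1); auto. }
  assert (HF : forall x, Defs.primitive (fun x => - w1 x) x = w 0 - w x).
  { intros x; apply is_RInt_unique.
    replace (w 0 - w x) with (scal (x - 0) 0 + -1 * (w x - w 0))
      by (unfold scal; simpl; unfold mult; simpl; ring).
    apply is_RInt_eq with (fun y => 0 + -1 * w1 y); [intros; ring|].
    apply is_RInt_linear; [apply (is_RInt_const (V := R_NormedModule))|].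
    apply is_RInt_R_derive; auto. }
  destruct (normG2_expand v (fun x => - w1 x) v_pos Cv Cf) as [I0 [HQ _]].
  set (i := RInt (fun x => / v x) 0 1) in *.
  assert (Cinv : forall x, continuous (fun x => / v x) x).
  { intros x; apply continuous_Rinv_comp; [apply Cv|apply Rgt_not_eq, v_pos]. }
  (* The primitive of [- tau_x] is [w 0 - w]. Since [w / v = (chi' o v)_x] integrates to zero, its
     weighted mean is [w 0], and subtracting that leaves [- w = - tau]. *)
  assert (HJ : RInt (fun x => Defs.primitive (fun x => - w1 x) x * / v x) 0 1 = w 0 * i).
  { apply is_RInt_unique.
    assert (B := is_RInt_R_derive (fun x => Derive_n chi 1 (v x)) 
      (fun x => vx x * Derive_n chi 2 (v x)) 0 1
      (fun x => proj1 (is_derive_in_True _ x _)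
          (is_derive_in_comp (fun _ => True) (Derive_n chi 1) v x _ _ I
             (proj2 (is_derive_in_True v x _) (Dv x))
             (is_derive_Derive_n chi 1 (v x) chi_smooth (v_pos x))))
      (fun x => continuous_mult vx (fun x => Derive_n chi 2 (v x)) x (Cvx x) (Cchi 2%nat x))).
    replace (_ - _) with 0 in B by (rewrite v_periodic; ring).
    assert (L := is_RInt_linear _ _ 0 1 (w 0) _ _
      (is_RInt_linear (fun _ => 0) _ 0 1 (-1) _ _
         (is_RInt_const (V := R_NormedModule) 0 1 0) B) (is_RInt_continuous _ 0 1 Cinv)).
    replace (w 0 * i) with (scal (1 - 0) 0 + -1 * 0 + w 0 * i)
      by (unfold scal; simpl; unfold mult; simpl; ring).
    revert L; apply is_RInt_eq; intros x; rewrite HF; unfold w, flux, chi_uu; field.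
    apply Rgt_not_eq, v_pos. }
  apply RInt_eq; intros x; rewrite HQ, HJ, HF, tau_flux.
  fold (w x); field; split; [apply Rgt_not_eq, v_pos|lra].
Qed.

End FlowIdentities.

Lemma M1_periodic_derivative (v vx : R -> R) :
  M1 v -> (forall x : R, is_derive v x (vx x)) -> v 1 = v 0 /\ vx 1 = vx 0.
Proof.
  intros [_ [Per _]] Dv.
  assert (A := Per 0); assert (B := is_derive_periodic v vx 0 Per Dv).
  rewrite Rplus_0_l in A, B; auto.
Qed.

Lemma chi_flow_dflux (chi : R -> R) (T : R -> Prop) (u ux uxx : R -> R -> R) :
  smooth_pos chi -> chi_flow chi T u ->
  (forall t x, T t -> 0 < u t x) ->
  (forall t x, T t -> is_derive (u t) x (ux t x)) ->
  (forall t x, T t -> is_derive (ux t) x (uxx t x)) ->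
  forall t x, T t -> is_derive_in T (fun t' => u t' x) t
    (- dflux chi (u t x) (ux t x) (ux t x) (uxx t x)).
Proof.
  intros S Flow Pos Dx Dxx t x Tt.
  rewrite <- (is_derive_unique _ _ _
    (is_derive_tau chi (u t) (ux t) (uxx t) x S (fun y => Pos t y Tt)
       (fun y => Dx t y Tt) (fun y => Dxx t y Tt))).
  exact (Flow t x Tt).
Qed.

(** * Freezing one of the three variables *)

Section Slices.
Context (A B : R -> Prop) (f : R -> R -> R -> R).
Context (Cf : continuous_on (fun p : R * R * R => A (fst (fst p)) /\ B (snd (fst p)))
                (fun p : R * R * R => f (fst (fst p)) (snd (fst p)) (snd p))).

Lemma continuous_on_slice (D : R * R -> Prop) (g : R * R -> R * R * R) :
  (forall p, D p -> A (fst (fst (g p))) /\ B (snd (fst (g p)))) ->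
  continuous_on D g ->
  continuous_on D (fun p => f (fst (fst (g p))) (snd (fst (g p))) (snd (g p))).
Proof.
  intros HD Cg; exact (continuous_on_comp D _ _ g HD Cg Cf).
Qed.

Lemma continuous_on_slice_tx (s : R) : B s ->
  continuous_on (strip A) (uncurry2 (fun t x => f t s x)).
Proof.
  intros Bs; apply (continuous_on_slice (strip A) (fun p => (fst p, s, snd p))).
  - intros p Ap; split; [exact Ap|exact Bs].
  - repeat apply continuous_on_pair; apply continuous_on_continuous; intros p _;
      [apply continuous_fst|apply continuous_const|apply continuous_snd].
Qed.

Lemma continuous_on_slice_sx (t : R) : A t ->
  continuous_on (strip B) (uncurry2 (fun s x => f t s x)).
Proof.
  intros At; apply (continuous_on_slice (strip B) (fun p => (t, fst p, snd p))).
  - intros p Bp; split; [exact At|exact Bp].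
  - repeat apply continuous_on_pair; apply continuous_on_continuous; intros p _;
      [apply continuous_const|apply continuous_fst|apply continuous_snd].
Qed.

Lemma continuous_on_slice_ts (x : R) :
  continuous_on (fun p => A (fst p) /\ B (snd p)) (uncurry2 (fun t s => f t s x)).
Proof.
  apply (continuous_on_slice (fun p => A (fst p) /\ B (snd p))
           (fun p => (fst p, snd p, x))); [auto|].
  repeat apply continuous_on_pair; apply continuous_on_continuous; intros p _;
    [apply continuous_fst|apply continuous_snd|apply continuous_const].
Qed.

End Slices.

(** What remains for the general norm computation is the linearised flow for [u_s]. The flow turns
    [u_t] into [- tau_x], whose [s]-derivative is known, and the exchange of [t] and [s] makes it
    the [t]-derivative of [u_s]. *)
Lemma normG2_decay (chi : R -> R) (T : R -> Prop) (u us : R -> R -> R -> R) :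
  smooth_pos chi -> concave_pos chi -> interval T ->
  smooth3 T unit_interval u ->
  (forall t s, T t -> unit_interval s -> M1 (u t s)) ->
  (forall s, unit_interval s -> chi_flow chi T (fun t => u t s)) ->
  (forall t s x, T t -> unit_interval s ->
     is_derive_in unit_interval (fun s' => u t s' x) s (us t s x)) ->
  forall t s, T t -> unit_interval s ->
    is_derive_in T (fun t' => normG2 (u t' s) (us t' s)) t
      (2 * RInt (fun x => chi_uu chi (u t s x) * (K (u t s) (us t s) x) ^ 2) 0 1) /\
    2 * RInt (fun x => chi_uu chi (u t s x) * (K (u t s) (us t s) x) ^ 2) 0 1 <= 0.
Proof.
  intros S Conc IT Sm HM Flow Dus t s Tt Ss.
  (* Order 3 is what the argument consumes: the highest derivative that enters is [fxx = u_sxx],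
     needed as a continuous function. *)
  destruct (Sm 3%nat) as [Cu [ut [f [ux [D1 [_ [Kf Kux]]]]]]].
  destruct Kf as [Cf [ft [fs [fx [D2 [_ [_ [Cfx [fxt [fxs [fxx [D3 [_ [_ [Cfxx _]]]]]]]]]]]]]]].
  destruct Kux as [Cux [uxt [uxs [uxx [D4 [_ [_ [Cuxx _]]]]]]]].
  assert (Pos : forall t s x, T t -> unit_interval s -> 0 < u t s x)
    by (intros r q x Tr Sq; apply (HM r q Tr Sq)).
  assert (Dx : forall t s x, T t -> unit_interval s -> is_derive (u t s) x (ux t s x))
    by (intros r q x Tr Sq; apply (D1 r q x Tr Sq)).
  assert (Ds : forall t s x, T t -> unit_interval s ->
    is_derive_in unit_interval (fun s' => u t s' x) s (f t s x))
    by (intros r q x Tr Sq; apply (D1 r q x Tr Sq)).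
  assert (Dxx : forall t s x, T t -> unit_interval s -> is_derive (ux t s) x (uxx t s x))
    by (intros r q x Tr Sq; apply (D4 r q x Tr Sq)).
  assert (Df : forall t s x, T t -> unit_interval s -> is_derive (f t s) x (fx t s x))
    by (intros r q x Tr Sq; apply (D2 r q x Tr Sq)).
  assert (Dfx : forall t s x, T t -> unit_interval s -> is_derive (fx t s) x (fxx t s x))
    by (intros r q x Tr Sq; apply (D3 r q x Tr Sq)).
  (* [us] is given only as a one-sided derivative; uniqueness identifies it with the smooth partial
     [f], at the endpoints of the parameter interval as well. *)
  assert (Eus : forall t s, T t -> unit_interval s -> us t s = f t s).
  { intros r q Tr Sq; apply functional_extensionality; intros x.
    apply (is_derive_in_unique unit_interval (fun s => u r s x) q);
      auto using interval_unit. }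
  assert (Du : forall t s x, T t -> unit_interval s -> is_derive_in T (fun t' => u t' s x) t
    (- dflux chi (u t s x) (ux t s x) (ux t s x) (uxx t s x))).
  { intros r q x Tr Sq.
    apply (chi_flow_dflux chi T (fun t => u t q) (fun t => ux t q) (fun t => uxx t q)); auto. }
  assert (Dw : forall t s x, T t -> unit_interval s ->
    is_derive_in unit_interval
      (fun s' => - dflux chi (u t s' x) (ux t s' x) (ux t s' x) (uxx t s' x)) s
      (- ddflux chi (u t s x) (ux t s x) (f t s x) (fx t s x)
           (ux t s x) (uxx t s x) (fx t s x) (fxx t s x))).
  { intros r q x Tr Sq.
    apply is_derive_in_ext with
      (fun s' => -1 * dflux chi (u r s' x) (ux r s' x) (ux r s' x) (uxx r s' x));
      [exact Sq|intros; ring|].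
    eapply is_derive_in_eq.
    - apply (is_derive_in_mult unit_interval (fun _ => -1)
        (fun s' => dflux chi (u r s' x) (ux r s' x) (ux r s' x) (uxx r s' x)) q 0);
        [exact Sq|apply is_derive_in_const, Sq|].
      apply (family_derivatives chi unit_interval (u r) (f r) (ux r) (uxx r) (fx r) (fxx r));
        auto using interval_unit.
      + exact (continuous_on_slice_sx T unit_interval f Cf r Tr).
      + exact (continuous_on_slice_sx T unit_interval fx Cfx r Tr).
      + exact (continuous_on_slice_sx T unit_interval fxx Cfxx r Tr).
    - ring. }
  (* The linearised flow. In [mixed_partials] the first partial is [u_t = - tau_x] and the mixed
     derivative is its [s]-derivative from [Dw]. *)
  assert (Tf : forall t s x, T t -> unit_interval s -> is_derive_in T (fun t' => f t' s x) t
      (- ddflux chi (u t s x) (ux t s x) (f t s x) (fx t s x)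
           (ux t s x) (uxx t s x) (fx t s x) (fxx t s x))).
  { intros r q x Tr Sq.
    assert (C := fun g Cg => continuous_on_slice_ts T unit_interval g Cg x).
    apply (mixed_partials T unit_interval (fun t s => u t s x)
      (fun t s => - dflux chi (u t s x) (ux t s x) (ux t s x) (uxx t s x))
      (fun t s => f t s x)
      (fun t s => - ddflux chi (u t s x) (ux t s x) (f t s x) (fx t s x)
           (ux t s x) (uxx t s x) (fx t s x) (fxx t s x))); auto using interval_unit.
    - intros q' Sq'; apply (continuous_on_opp T
        (fun t => dflux chi (u t q' x) (ux t q' x) (ux t q' x) (uxx t q' x))).
      assert (C' := fun g Cg => continuous_on_strip_slice T (fun t x => g t q' x) x
                (continuous_on_slice_tx T unit_interval g Cg q' Sq')).
      apply (continuous_on_dflux T chi S (fun t => u t q' x) (fun t => ux t q' x)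
               (fun t => ux t q' x) (fun t => uxx t q' x)); auto.
    - apply (continuous_on_opp _ (fun p => ddflux chi
        (uncurry2 (fun t s => u t s x) p) (uncurry2 (fun t s => ux t s x) p)
        (uncurry2 (fun t s => f t s x) p) (uncurry2 (fun t s => fx t s x) p)
        (uncurry2 (fun t s => ux t s x) p) (uncurry2 (fun t s => uxx t s x) p)
        (uncurry2 (fun t s => fx t s x) p) (uncurry2 (fun t s => fxx t s x) p))).
      apply continuous_on_ddflux; auto.
      intros p [Tp Sp]; apply Pos; assumption. }
  rewrite (Eus t s Tt Ss); split.
  - apply is_derive_in_ext with (fun t' => normG2 (u t' s) (f t' s)); [exact Tt| |].
    { intros r Tr; rewrite (Eus r s Tr Ss); reflexivity. }
    assert (C := fun g Cg => continuous_on_slice_tx T unit_interval g Cg s Ss).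
    apply (is_derive_in_normG2 chi T (fun t => u t s) (fun t => ux t s) (fun t => uxx t s)
      (fun t => f t s) (fun t => fx t s) (fun t => fxx t s)); auto.
    + intros r Tr; apply (M1_periodic_derivative (u r s) (ux r s)); auto.
    + intros r Tr; apply (M1_periodic_derivative (u r s) (ux r s)); auto.
    + intros r Tr; rewrite <- (Rplus_0_l 1) at 1.
      apply (family_periodic unit_interval (u r) (f r)); auto using interval_unit.
      intros q x Sq; apply (HM r q Tr Sq).
    + intros r Tr.
      apply (family_zero_mean unit_interval (u r) (f r) 1 s); auto using interval_unit.
      * intros q x Sq; exact (is_derive_continuous _ x _ (Dx r q x Tr Sq)).
      * exact (continuous_on_slice_sx T unit_interval f Cf r Tr).
      * intros q Sq; apply (HM r q Tr Sq).
  - apply dissipation_nonpos with (ux t s); auto; intros x.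
    + exact (is_derive_continuous _ x _ (Dxx t s x Tt Ss)).
    + exact (is_derive_continuous _ x _ (Df t s x Tt Ss)).
Qed.

Lemma Vol_second_derivative (chi : R -> R) (T : R -> Prop) (u ut : R -> R -> R) :
  smooth_pos chi -> concave_pos chi -> interval T ->
  smooth2 T u -> (forall t, T t -> M1 (u t)) -> chi_flow chi T u ->
  (forall t x, T t -> is_derive_in T (fun t' => u t' x) t (ut t x)) ->
  forall t, T t ->
    is_derive_in T (fun t' => Vol chi (u t')) t (E chi (u t)) /\
    is_derive_in T (fun t' => E chi (u t')) t
      (2 * RInt (fun x => chi_uu chi (u t x) * (K (u t) (ut t) x) ^ 2) 0 1) /\
    2 * RInt (fun x => chi_uu chi (u t x) * (K (u t) (ut t) x) ^ 2) 0 1 <= 0.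
Proof.
  intros S Conc IT Sm HM Flow Dut t Tt.
  destruct (Sm 3%nat) as [Cu [f [ux [D1 [Kf Kux]]]]].
  destruct Kf as [Cf [ft [fx [D2 [_ [Cfx [fxt [fxx [D3 [_ [Cfxx _]]]]]]]]]]].
  destruct Kux as [Cux [uxt [uxx [D4 [_ [Cuxx _]]]]]].
  assert (Pos : forall t x, T t -> 0 < u t x) by (intros r x Tr; apply (HM r Tr)).
  assert (Dx : forall t x, T t -> is_derive (u t) x (ux t x))
    by (intros r x Tr; apply (D1 r x Tr)).
  assert (Dt : forall t x, T t -> is_derive_in T (fun t' => u t' x) t (f t x))
    by (intros r x Tr; apply (D1 r x Tr)).
  assert (Dxx : forall t x, T t -> is_derive (ux t) x (uxx t x))
    by (intros r x Tr; apply (D4 r x Tr)).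
  assert (Df : forall t x, T t -> is_derive (f t) x (fx t x))
    by (intros r x Tr; apply (D2 r x Tr)).
  assert (Dfx : forall t x, T t -> is_derive (fx t) x (fxx t x))
    by (intros r x Tr; apply (D3 r x Tr)).
  assert (Du := chi_flow_dflux chi T u ux uxx S Flow Pos Dx Dxx).
  assert (Ef : forall t, T t ->
    f t = fun x => - dflux chi (u t x) (ux t x) (ux t x) (uxx t x)).
  { intros r Tr; apply functional_extensionality; intros x.
    apply (is_derive_in_unique T (fun t => u t x) r); auto. }
  assert (Eut : ut t = f t).
  { apply functional_extensionality; intros x.
    apply (is_derive_in_unique T (fun t => u t x) t); auto. }
  assert (Cxx : forall t x, T t -> continuous (uxx t) x)
    by (intros r x Tr; exact (continuous_strip_section T uxx r x Cuxx Tr)).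
  assert (Per : forall t, T t -> u t 1 = u t 0 /\ ux t 1 = ux t 0)
    by (intros r Tr; apply M1_periodic_derivative; auto).
  (* The flow is autonomous, so its velocity solves the linearised flow: [f = - tau_x] for all times
     in [T], and this identity is differentiated in [t]. *)
  assert (Tf : forall t x, T t -> is_derive_in T (fun t' => f t' x) t
      (- ddflux chi (u t x) (ux t x) (f t x) (fx t x)
           (ux t x) (uxx t x) (fx t x) (fxx t x))).
  { intros r x Tr.
    apply is_derive_in_ext with
      (fun t' => -1 * dflux chi (u t' x) (ux t' x) (ux t' x) (uxx t' x)); [exact Tr| |].
    { intros q Tq; rewrite (Ef q Tq); ring. }
    eapply is_derive_in_eq.
    - apply (is_derive_in_mult T (fun _ => -1)
        (fun t' => dflux chi (u t' x) (ux t' x) (ux t' x) (uxx t' x)) r 0);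
        [exact Tr|apply is_derive_in_const, Tr|].
      apply (family_derivatives chi T u f ux uxx fx fxx); auto.
    - ring. }
  rewrite Eut; split; [|split].
  - apply is_derive_in_eq with
      (RInt (fun x => f t x * Derive_n chi 1 (u t x)) 0 1).
    + apply (is_derive_in_RInt_param T (fun t x => chi (u t x))
               (fun t x => f t x * Derive_n chi 1 (u t x))); auto.
      * intros r x Tr; apply (is_derive_in_comp T chi (fun t => u t x)); auto.
        exact (is_derive_Derive_n chi 0 (u r x) S (Pos r x Tr)).
      * apply (continuous_on_mult (strip T) (uncurry2 f)
                 (fun p => Derive_n chi 1 (uncurry2 u p))); [exact Cf|].
        apply continuous_on_Derive_n; [exact S|intros p; apply Pos|exact Cu].
      * intros r x Tr; apply (continuous_comp (u r) chi).
        -- exact (is_derive_continuous _ x _ (Dx r x Tr)).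
        -- exact (continuous_Derive_n chi 0 (u r x) S (Pos r x Tr)).
    + apply is_RInt_unique; rewrite (Ef t Tt).
      apply RInt_flow_Vol; auto; apply (Per t Tt).
  (* [E] equals the squared norm of the velocity at every time in [T], so the general norm
     computation with [f = u_t] gives its derivative. *)
  - apply is_derive_in_ext with (fun t' => normG2 (u t') (f t')); [exact Tt| |].
    { intros r Tr; rewrite (Ef r Tr); apply normG2_flow; auto; apply (Per r Tr). }
    apply (is_derive_in_normG2 chi T u ux uxx f fx fxx); auto.
    + intros r Tr; apply (Per r Tr).
    + intros r Tr; apply (Per r Tr).
    + intros r Tr; rewrite <- (Rplus_0_l 1) at 1.
      apply (family_periodic T u f); auto.
      intros q x Tq; apply (HM q Tq).
    + intros r Tr; apply (family_zero_mean T u f 1 r); auto.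
      * intros q x Tq; exact (is_derive_continuous _ x _ (Dx q x Tq)).
      * intros q Tq; apply (HM q Tq).
  - apply dissipation_nonpos with (ux t); auto; intros x.
    + exact (is_derive_continuous _ x _ (Dxx t x Tt)).
    + exact (is_derive_continuous _ x _ (Df t x Tt)).
Qed.

Theorem proposition5p24 (chi : R -> R)
  (chi_smooth : smooth_pos chi)
  (chi_nonneg : forall y : R, 0 < y -> 0 <= chi y)
  (chi_concave : concave_pos chi)
  (T : R -> Prop) (T_interval : interval T) :
  (forall u us : R -> R -> R -> R,
     smooth3 T unit_interval u ->
     (forall t s : R, T t -> unit_interval s -> M1 (u t s)) ->
     (forall s : R, unit_interval s -> chi_flow chi T (fun t => u t s)) ->
     (forall t s x : R, T t -> unit_interval s ->
        is_derive_in unit_interval (fun s' => u t s' x) s (us t s x)) ->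
     forall t s : R, T t -> unit_interval s ->
       is_derive_in T (fun t' => normG2 (u t' s) (us t' s)) t
         (2 * RInt (fun x => chi_uu chi (u t s x) * (K (u t s) (us t s) x) ^ 2) 0 1) /\
       2 * RInt (fun x => chi_uu chi (u t s x) * (K (u t s) (us t s) x) ^ 2) 0 1 <= 0) /\
  (forall u ut : R -> R -> R,
     smooth2 T u ->
     (forall t : R, T t -> M1 (u t)) ->
     chi_flow chi T u ->
     (forall t x : R, T t -> is_derive_in T (fun t' => u t' x) t (ut t x)) ->
     exists dVol : R -> R,
       (forall t : R, T t -> is_derive_in T (fun t' => Vol chi (u t')) t (dVol t)) /\
       forall t : R, T t ->
         is_derive_in T dVol t
           (2 * RInt (fun x => chi_uu chi (u t x) * (K (u t) (ut t) x) ^ 2) 0 1) /\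
         is_derive_in T (fun t' => E chi (u t')) t
           (2 * RInt (fun x => chi_uu chi (u t x) * (K (u t) (ut t) x) ^ 2) 0 1) /\
         2 * RInt (fun x => chi_uu chi (u t x) * (K (u t) (ut t) x) ^ 2) 0 1 <= 0).
Proof.
  split.
  - intros u us Sm HM Flow Dus.
    exact (normG2_decay chi T u us chi_smooth chi_concave T_interval Sm HM Flow Dus).
  (* [E] is the first derivative of the volume along the flow, so the same formula serves for its
     derivative and for the second derivative of the volume. *)
  - intros u ut Sm HM Flow Dut; exists (fun t => E chi (u t)).
    assert (H := Vol_second_derivative chi T u ut chi_smooth chi_concave T_interval
                   Sm HM Flow Dut).
    split; intros t Tt; destruct (H t Tt) as [H1 [H2 H3]]; auto.
Qed.
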